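(* Let $\mathsf{G}\subseteq\mathsf{P}^n$ be a group of Pauli matrices with a maximal stabilizer subgroup $\mathsf{S}$. Then, for any sufficiently small $\epsilon,\delta>0$ and assuming $\tfrac12$-weak, $\tfrac12$-stable, GTM noise, an estimator $\hat{\boldsymbol p}_{\mathsf{A_G}}$ of $\boldsymbol p_{\mathsf{A_G}}$ satisfying $$\|\hat{\boldsymbol p}_{\mathsf{A_G}}-\boldsymbol p_{\mathsf{A_G}}\|_2\le O(\epsilon)\,\|\boldsymbol r_{\mathsf{G}}\|_\infty$$ with probability at least $1-\delta$ can be obtained using $t=\frac{2}{\epsilon^2}\log\big(\frac{2|\kappa||\mathsf{G}|}{\delta}\big)$ measurements per round for $|\kappa|\big(\sqrt{|\mathsf{G}/\mathsf{S}|}+1\big)$ rounds, where $\kappa$ is the set of sequence lengths used, $|\kappa|=O\big(\log\tfrac1{\Delta_{\mathsf{G}}}\big)$, and $m_{\max}=O\big(\tfrac1{\Delta_{\mathsf{G}}}\big)$ is the longest sequence length used.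
   Context: Pauli labels. Let $d=2^n$. $\mathsf{P}^n$ denotes the $n$-qubit Pauli group modulo phases, identified with $\mathbb{Z}_2^{2n}$: $a=(a_x,a_z)$ labels the Hermitian matrix $P_a=i^{a_x\cdot a_z}X[a_x]Z[a_z]$, where $A[v]=\bigotimes_iA^{v_i}$ and $X,Z$ are the single-qubit Pauli matrices. Let $\langle a,b\rangle=a_x\cdot b_z+a_z\cdot b_x\bmod 2$. A stabilizer group is a subgroup of $\mathsf{P}^n$ on which $\langle\cdot,\cdot\rangle$ vanishes identically. For a group $\mathsf{G}\subseteq\mathsf{P}^n$, $\mathsf{C_G}=\{a\in\mathsf{P}^n:\langle a,g\rangle=0\ \forall g\in\mathsf{G}\}$ and $\mathsf{A_G}=\mathsf{P}^n/\mathsf{C_G}$. Write $|a)=d^{-1/2}P_a$ as a vector in the Hilbert–Schmidt space with $(A|B)=\mathrm{Tr}(A^\dagger B)$; channels act as superoperators; $\mathcal{P}_a(M)=P_aMP_a^\dagger$. Noise model. GTM (gate-independent, time-stationary, Markovian) means: there is a fixed completely positive trace-preserving map $\Lambda$ such that the noisy implementation of every Pauli gate $\mathcal{P}_a$ is, at every time, $\mathcal{P}_a\Lambda$, and state preparations and measurements are described by fixed density operators and POVMs: $\tilde\rho_{\mathsf{H},0}$ is the noisy preparation of the stabilizer state $\frac1d\sum_{s\in\mathsf{H}}P_s$ of a stabilizer group $\mathsf{H}$, and $\{\tilde E_{\mathsf{H},b}:b\in\mathsf{A_H}\}$ is the noisy syndrome measurement of $\mathsf{H}$. Pauli eigenvalues: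 $f_a=(a|\Lambda|a)$; $r_a=1-f_a$; $\boldsymbol r_{\mathsf{G}}=(r_g)_{g\in\mathsf{G}}$. Pauli error rates: $p_a=4^{-n}\sum_{b\in\mathsf{P}^n}(-1)^{\langle a,b\rangle}f_b$. Marginal distribution: $p_{\mathsf{A_G},a}=\sum_{c\in\mathsf{C_G}}p_{a+c}$ for $a\in\mathsf{A_G}$, and $\boldsymbol p_{\mathsf{A_G}}=(p_{\mathsf{A_G},a})_{a\in\mathsf{A_G}}$. The noise is $\tfrac12$-weak if $f_a\in[\tfrac12,1]$ for all $a\in\mathsf{P}^n$. It is $\tfrac12$-stable if each SPAM (state preparation and measurement) parameter $A_h=\sum_{b\in\mathsf{A_H}}(-1)^{\langle h,b\rangle}(\tilde E_{\mathsf{H},b}|h)(h|\Lambda|\tilde\rho_{\mathsf{H},0})$, $h\in\mathsf{H}$, satisfies $A_h\ge\tfrac12$. Spectral gap: $\Delta_{\mathsf{G}}=1-\max_{g\in\mathsf{G}\setminus\{0\}}|f_g|$. Measurements. One measurement is one run of the following experiment for a stabilizer group $\mathsf{H}$ and a sequence length $m$: prepare $\tilde\rho_{\mathsf{H},0}$; for $i=0,\dots,m$ apply a noisy Pauli gate $P_{a_i}$ with $a_i\in\mathsf{P}^n$ uniformly random; perform the noisy syndrome measurement of $\mathsf{H}$ with outcome $b$; return the class $z\in\mathsf{A_H}$ of $b+\sum_ia_i$. A round consists of the $t$ measurements made for one stabilizer group and one sequence length. The implicit constants in $O(\cdot)$ are absolute.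
   Formalization: ''Maximal stabilizer subgroup'' S is read as maximal among stabilizer subgroups of G commuting with all of G (S = G ∩ C_G); for an inclusion-maximal stabilizer subgroup the round count √|G/S|+1 is false (G = P^n: non-integer for odd n, too few groups for large n). *)

(* Defs.v *)
From HB Require Import structures.
From mathcomp Require Import all_boot all_order all_fingroup all_algebra.
From mathcomp Require Import complex reals exp.

Set Implicit Arguments.
Unset Strict Implicit.
Unset Printing Implicit Defensive.

Import Order.TTheory GRing.Theory Num.Theory.

Local Open Scope ring_scope.
Local Open Scope sesquilinear_scope.

(* A label a in Z_2^(2n) is the row vector (a_x | a_z).  The finite group
   structure of this type is the additive one, so that subgroups of P^n are
   terms of type {group pauli n}, with  a * b = a + b  and  1 = 0. *)
Notation pauli n := 'rV['F_2]_(n + n).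

Section Labels.
Variable n : nat.
Implicit Types (a b : pauli n) (G H S : {group pauli n}).

Definition xpart a : 'rV['F_2]_n := lsubmx a.
Definition zpart a : 'rV['F_2]_n := rsubmx a.

Definition symp a b : 'F_2 :=
  (xpart a *m (zpart b)^T + zpart a *m (xpart b)^T) 0 0.

Definition commutant_set G : {set pauli n} :=
  [set a | [forall g in G, symp a g == 0]].

Lemma commutant_group_set G : group_set (commutant_set G).
Proof.
have sD a b c : symp (a + b) c = symp a c + symp b c.
  rewrite /symp /xpart /zpart !linearD /= !mulmxDl !mxE.
  by rewrite addrACA.
apply/group_setP; split=> [|a b].
  rewrite inE; apply/forall_inP => g _; apply/eqP.
  apply: (@addrI _ (symp 0 g)).
  by rewrite -sD !addr0.
rewrite !inE => /forall_inP Ca /forall_inP Cb; apply/forall_inP => g Gg.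
by rewrite (sD a b) (eqP (Ca g Gg)) (eqP (Cb g Gg)) addr0.
Qed.
Canonical commutant G : {group pauli n} := Group (commutant_group_set G).

(* A_G = P^n / C_G.  As P^n is abelian, every label lies in the normaliser of
   C_G, so this type is the whole quotient. *)
Definition syndrome G : finType := coset_of (commutant G).

Definition syndrome_of G a : syndrome G := coset (commutant G) a.

(* b + [a], written multiplicatively in the quotient. *)
Definition syndrome_shift G (b : syndrome G) a : syndrome G :=
  ((b : coset_of (commutant G)) * coset (commutant G) a)%g.

(* The labels in the class b. *)
Definition syndrome_set G (b : syndrome G) : {set pauli n} :=
  (b : coset_of (commutant G)).

Definition stabilizer_group H : bool :=
  [forall a in H, forall b in H, symp a b == 0].

(* S is the stabilizer of G in the sense of subsystem codes: a maximal one
   among the stabilizer subgroups of G that commute with all of G.  Then G / S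
   is the label group of k qubits and sqrt |G / S| = 2 ^ k. *)
Definition maximal_stabilizer_subgroup S G : bool :=
  [max S | [&& S \subset G, stabilizer_group S & S \subset commutant G]]%g.

End Labels.

Section Noise.
Variable R : realType.
Local Notation C := R[i].

Definition hs m (A B : 'M[C]_m) : C := \tr (A^t* *m B).

Definition psd m (A : 'M[C]_m) : Prop :=
  forall u : 'cV[C]_m, 0 <= (u^t* *m A *m u) 0 0.

Definition density_operator m (A : 'M[C]_m) : Prop := psd A /\ \tr A = 1.

(* A k x k block matrix with blocks B i j is an element of M_k (x) M_m, on
   which id (x) Lam acts blockwise. *)
Definition completely_positive m (Lam : 'M[C]_m -> 'M[C]_m) : Prop :=
  forall (k : nat) (B : 'I_k -> 'I_k -> 'M[C]_m),
    psd (\mxblock_(i < k, j < k) B i j) ->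
    psd (\mxblock_(i < k, j < k) Lam (B i j)).

Definition trace_preserving m (Lam : 'M[C]_m -> 'M[C]_m) : Prop :=
  forall A, \tr (Lam A) = \tr A.

Definition sigmaX : 'M[C]_2 := \matrix_(i, j) (i != j)%:R.
Definition sigmaZ : 'M[C]_2 := \matrix_(i, j) (if i == j then (-1) ^+ i else 0).

Section Qubits.
Variable n : nat.
Implicit Types (a h : pauli n) (G H : {group pauli n}).

(* The computational basis of (C^2)^(x n) is indexed by {0, 1}^n, enumerated
   by the ordinals below d = 2 ^ n. *)
Definition qdim : nat := #|{ffun 'I_n -> 'I_2}|.

Lemma qdimE : qdim = (2 ^ n)%N.
Proof. by rewrite /qdim card_ffun !card_ord. Qed.

Definition qbits (x : 'I_qdim) : {ffun 'I_n -> 'I_2} := enum_val x.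

Local Notation op := 'M[C]_qdim.

Definition tensor (A : 'I_n -> 'M[C]_2) : op :=
  \matrix_(x, y) \prod_(k < n) A k (qbits x k) (qbits y k).

Definition tensor_pow (A : 'M[C]_2) (v : 'rV['F_2]_n) : op :=
  tensor (fun k => A ^+ (v 0 k)).

(* The exponent a_x . a_z is the natural number of tensor factors Y. *)
Definition pauli_mx a : op :=
  'i ^+ (\sum_(k < n) (xpart a 0%R k * zpart a 0%R k))%N
    *: (tensor_pow sigmaX (xpart a) *m tensor_pow sigmaZ (zpart a)).

Definition pauli_vec a : op := (sqrtC qdim%:R)^-1 *: pauli_mx a.

Definition pauli_gate a (M : op) : op := pauli_mx a *m M *m (pauli_mx a)^t*.

Record noise := Noise {
  chan : {linear op -> op};
  prep : {group pauli n} -> op;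
  povm : forall H : {group pauli n}, syndrome H -> op
}.

Implicit Types N : noise.

Definition gtm N : Prop :=
  [/\ completely_positive (chan N), trace_preserving (chan N) &
   forall H, stabilizer_group H ->
     [/\ density_operator (prep N H),
         forall b, psd (@povm N H b) &
         \sum_b @povm N H b = 1%:M]].

(* f_a; it is a real number since chan N preserves Hermitian operators. *)
Definition pauli_eigenvalue N a : R :=
  complex.Re (hs (pauli_vec a) (chan N (pauli_vec a))).

Definition infidelity N a : R := 1 - pauli_eigenvalue N a.

Definition infidelity_norm N G : R :=
  \big[Order.max/0]_(g in G) `|infidelity N g|.

Definition pauli_sign a b : R := (-1) ^+ (symp a b).

Definition pauli_rate N a : R :=
  (4 ^+ n)^-1 * \sum_b pauli_sign a b * pauli_eigenvalue N b.

Definition marginal_rate N G (a : syndrome G) : R :=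
  \sum_(c in syndrome_set a) pauli_rate N c.

(* <h, b> for h in H and b in A_H, computed on a representative of b; A_h is
   real since povm and chan (prep) are Hermitian. *)
Definition spam N H h : R :=
  complex.Re (\sum_(b : syndrome H)
    (pauli_sign h (repr (syndrome_set b)))%:C%C *
    hs (@povm N H b) (pauli_vec h) * hs (pauli_vec h) (chan N (prep N H))).

Definition half_weak N : Prop :=
  forall a, 2^-1 <= pauli_eigenvalue N a <= 1.

Definition half_stable N : Prop :=
  forall H, stabilizer_group H -> {in H, forall h, 2^-1 <= spam N H h}.

(* The maximum over the empty set (trivial G) is 0. *)
Definition spectral_gap N G : R :=
  1 - \big[Order.max/0]_(g in G | g != 0) `|pauli_eigenvalue N g|.

(* State after noisy gates with labels a_0, ..., a_m, head of the list first. *)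
Definition run_state N H (a : seq (pauli n)) : op :=
  foldl (fun M ai => pauli_gate ai (chan N M)) (prep N H) a.

(* Probability that one run with stabilizer group H and length m returns z. *)
Definition run_prob N H (m : nat) (z : syndrome H) : R :=
  \sum_(a : m.+1.-tuple (pauli n)) ((#|{: pauli n}|%:R)^-1) ^+ m.+1 *
    \sum_(b : syndrome H | syndrome_shift b (\sum_(ai <- a) ai) == z)
      complex.Re (hs (@povm N H b) (run_state N H a)).

(* Outcomes of t runs in each of r rounds, round i using group H i. *)
Definition data r t (H : 'I_r -> {group pauli n}) : finType :=
  {dffun forall x : 'I_r * 'I_t, syndrome (H x.1)}.

Definition data_prob N r t (H : 'I_r -> {group pauli n}) (m : 'I_r -> nat)
    (D : data t H) : R :=
  \prod_(x : 'I_r * 'I_t) run_prob N (m x.1) (D x).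

Definition prob N r t (H : 'I_r -> {group pauli n}) (m : 'I_r -> nat)
    (E : pred (data t H)) : R :=
  \sum_(D : data t H | E D) data_prob N m D.

End Qubits.

Definition l2norm (T : finType) (v : T -> R) : R :=
  Num.sqrt (\sum_x v x ^+ 2).

(* 2 / eps ^ 2 * log (2 k c / delta), rounded up to an integer. *)
Definition shots (eps delta : R) (k c : nat) : nat :=
  `|Num.ceil (2 / eps ^+ 2 * ln (2 * k%:R * c%:R / delta))|%N.

End Noise.

(* Main.v *)
Require Import Defs.
From HB Require Import structures.
From mathcomp Require Import all_boot all_order all_fingroup all_algebra.
From mathcomp Require Import finfield.
From mathcomp Require Import boolp complex reals sequences exp.
From mathcomp Require Import ring lra.

Set Implicit Arguments.
Unset Strict Implicit.
Unset Printing Implicit Defensive.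

Import Order.TTheory GRing.Theory Num.Theory.

Local Open Scope ring_scope.
Local Open Scope sesquilinear_scope.

(** Let S be the radical of the symplectic form on G.  Then G / S has a
    symplectic basis of 2 k vectors, and the multiplication tables of the field
    with 2 ^ k elements give a symplectic spread: 2 ^ k + 1 stabilizer groups
    covering G.  Pauli twirling turns the average of (-1) ^ <g, z> over the
    outcomes z of the runs of length m into an estimate of A_g f_g ^ m, which
    Chernoff's bound makes accurate to O(eps) for every g in G and every m in
    {0, 1, 2, 4, ..., 2 ^ J}, where 2 ^ J is about 1 / Delta.

    The estimate of the marginal rates is that of an arbitrary admissible noise
    whose values A_g f_g ^ m are all compatible with the data.  If two noises are
    compatible with the same data, look at the length m for which f_g ^ m lies in
    [1/4, 1/2]: there m r_g is of order 1, and an error O(eps) on f_g ^ m forces an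
    error O(eps / m) = O(eps r_g) on f_g.  Parseval's identity on G carries this
    over to the marginal rates in the Euclidean norm. *)

(** * Labels and characters *)

Section Characters.
Variable n : nat.
Implicit Types (a b c g : pauli n) (G H S : {group pauli n}).

Lemma F2_cases (x : 'F_2) : (x == 0) || (x == 1).
Proof. by case: x => [[|[|m]] m2]. Qed.

Lemma addrr_F2 (x : 'F_2) : x + x = 0.
Proof. by case/orP: (F2_cases x) => /eqP ->; apply/eqP. Qed.

Lemma addrr_F2row m (a : 'rV['F_2]_m) : a + a = 0.
Proof. by apply/rowP => i; rewrite !mxE addrr_F2. Qed.

Lemma oppr_F2row m (a : 'rV['F_2]_m) : - a = a.
Proof. by apply/eqP; rewrite eq_sym -addr_eq0 addrr_F2row. Qed.

Lemma sympDl a b c : symp (a + b) c = symp a c + symp b c.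
Proof.
rewrite /symp /xpart /zpart !linearD /= !mulmxDl !mxE.
by rewrite addrACA.
Qed.

Lemma sympC a b : symp a b = symp b a.
Proof.
rewrite /symp !mxE addrC; congr (_ + _); apply: eq_bigr => i _;
  by rewrite !mxE mulrC.
Qed.

Lemma sympDr a b c : symp a (b + c) = symp a b + symp a c.
Proof. by rewrite sympC sympDl !(sympC a). Qed.

Lemma symp0 a : symp 0 a = 0.
Proof. by apply: (@addrI _ (symp 0 a)); rewrite -sympDl !addr0. Qed.

Lemma sympp a : symp a a = 0.
Proof.
rewrite /symp !mxE -[RHS](addrr_F2 (\sum_j xpart a 0 j * zpart a 0 j)).
by congr (_ + _); apply: eq_bigr => i _; rewrite !mxE // mulrC.
Qed.

Lemma symp_nondegenerate a : (forall b, symp a b = 0) -> a = 0.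
Proof.
move=> a0; apply/rowP => i; rewrite mxE.
pose e k : 'rV['F_2]_n := delta_mx 0 k.
case: (split_ordP i) => k ->.
  have := a0 (row_mx 0 (e k)).
  rewrite /symp /xpart /zpart row_mxKl row_mxKr trmx0 mulmx0 addr0 mxE.
  rewrite (bigD1 k) //= big1 => [|j jk]; rewrite !mxE eqxx ?eqxx.
    by rewrite mulr1 addr0.
  by rewrite (negPf jk) mulr0.
have := a0 (row_mx (e k) 0).
rewrite /symp /xpart /zpart row_mxKl row_mxKr trmx0 mulmx0 add0r mxE.
rewrite (bigD1 k) //= big1 => [|j jk]; rewrite !mxE eqxx ?eqxx.
  by rewrite mulr1 addr0.
by rewrite (negPf jk) mulr0.
Qed.

Lemma commutantP G a : reflect {in G, forall g, symp a g = 0} (a \in commutant G).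
Proof.
rewrite inE; apply: (iffP forall_inP) => h g Gg; first exact/eqP/h.
by rewrite h.
Qed.

Lemma stabilizerP H :
  reflect {in H &, forall a b, symp a b = 0} (stabilizer_group H).
Proof.
apply: (iffP forall_inP) => h a; last first.
  by move=> aH; apply/forall_inP => b bH; rewrite h.
by move=> b aH bH; apply/eqP; move/forall_inP: (h a aH); apply.
Qed.

Lemma pauli_groupD G : {in G &, forall a b, a + b \in G}.
Proof. exact: groupM. Qed.

Lemma pauli_group0 G : 0 \in G.
Proof. exact: group1. Qed.

Lemma pauli_abelian G : abelian G.
Proof. exact: FinRing.zmod_abelian. Qed.

Lemma pauli_norm a G : a \in 'N(G)%g.
Proof.
have /normal_norm/subsetP-> // : (G <| [set: pauli n])%g.
by rewrite -sub_abelian_normal ?subsetT ?(pauli_abelian [set: pauli n]%G).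
Qed.

Lemma card_pauli : #|{: pauli n}| = (4 ^ n)%N.
Proof. by rewrite card_mx card_Fp // mul1n addnn -mul2n expnM. Qed.

(** * Character sums and duality of commutants *)

Variable R : realType.
Local Notation sgn := (@pauli_sign R n).

Lemma signrF2 (x y : 'F_2) : (-1) ^+ (x + y)%R = (-1) ^+ x * (-1) ^+ y :> R.
Proof.
by case/orP: (F2_cases x) => /eqP ->; case/orP: (F2_cases y) => /eqP -> /=;
  rewrite ?expr0 ?expr1 ?mulr1 ?mul1r ?mulrNN ?mulr1.
Qed.

Lemma pauli_signDl a b c : sgn (a + b) c = sgn a c * sgn b c.
Proof. by rewrite /pauli_sign sympDl signrF2. Qed.

Lemma pauli_signC a b : sgn a b = sgn b a.
Proof. by rewrite /pauli_sign sympC. Qed.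

Lemma pauli_signDr a b c : sgn a (b + c) = sgn a b * sgn a c.
Proof. by rewrite !(pauli_signC a) pauli_signDl. Qed.

Lemma pauli_sign2 a b : sgn a b ^+ 2 = 1.
Proof. by rewrite /pauli_sign sqrr_sign. Qed.

Lemma pauli_sign1 a b : symp a b = 0 -> sgn a b = 1.
Proof. by rewrite /pauli_sign => ->. Qed.

Lemma pauli_signN1 a b : symp a b != 0 -> sgn a b = -1.
Proof.
by rewrite /pauli_sign; case/orP: (F2_cases (symp a b)) => /eqP ->.
Qed.

(** If some [h] in [G] anticommutes with [a], translating the sum by [h] reverses its sign, so it
    vanishes. *)
Lemma sum_pauli_sign G a :
  \sum_(g in G) sgn a g = if a \in commutant G then #|G|%:R else 0.
Proof.
case: ifPn => [/commutantP aG|].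
  by under eq_bigr => g gG do rewrite pauli_sign1 ?aG//; rewrite sumr_const.
rewrite inE negb_forall_in => /exists_inP[h hG /pauli_signN1 sah].
set s := \sum_(g in G) _.
have : s = - s.
  rewrite {1}/s (reindex_inj (addrI h)) /= -mulN1r -sah mulr_sumr.
  rewrite (eq_bigl (mem G)) => [|g /=]; last first.
    by rewrite -[RHS](groupMl _ hG).
  by apply: eq_bigr => g _; rewrite pauli_signDr.
by move/eqP; rewrite -addr_eq0 -mulr2n mulrn_eq0 => /eqP.
Qed.

Lemma commutantT a : (a \in commutant [set: pauli n]%G) = (a == 0).
Proof.
apply/idP/eqP => [/commutantP h|->]; last exact: pauli_group0.
by apply: symp_nondegenerate => b; rewrite h ?inE.
Qed.

Lemma sum_pauli_signT a : \sum_g sgn a g = if a == 0 then 4 ^+ n else 0.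
Proof.
rewrite -commutantT -natrX -card_pauli -cardsT.
by rewrite -(sum_pauli_sign [set: pauli n]%G); apply: eq_bigl => g; rewrite inE.
Qed.

(** Double counting of signs over all [a] and all [g] in [G]: summing over [g] first gives the
    left-hand side, summing over [a] first leaves only g = 0. *)
Lemma card_commutant G : (#|G| * #|commutant G| = 4 ^ n)%N.
Proof.
apply/eqP; rewrite -(eqr_nat R) natrM natrX.
have : \sum_a \sum_(g in G) sgn a g = #|G|%:R * #|commutant G|%:R.
  under eq_bigr do rewrite sum_pauli_sign.
  by rewrite -big_mkcond sumr_const mulr_natr.
rewrite exchange_big /= (bigD1 0) ?pauli_group0//= [X in _ + X]big1
  => [|g /andP[_ /negPf g0]].
  by under eq_bigr do rewrite pauli_signC; rewrite sum_pauli_signT eqxx addr0 => <-.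
by under eq_bigr do rewrite pauli_signC; rewrite sum_pauli_signT g0.
Qed.

(** Symmetry of the form puts [G] inside its double commutant; [card_commutant] used twice gives
    equal orders. *)
Lemma commutantK G : commutant (commutant G) = G.
Proof.
apply/val_inj/esym/eqP; rewrite /= eqEcard; apply/andP; split.
  apply/subsetP => g gG; apply/commutantP => a /commutantP aG.
  by rewrite sympC aG.
have := card_commutant (commutant G); rewrite -(card_commutant G) mulnC.
by move/eqP; rewrite eqn_pmul2r ?cardG_gt0// => /eqP ->.
Qed.

(** * Signs of syndromes and Parseval's identity *)

Lemma syndrome_set_coset G a :
  syndrome_set (syndrome_of G a) = (commutant G :* a)%g.
Proof. by rewrite /syndrome_set /syndrome_of val_coset ?pauli_norm. Qed.

Lemma mem_syndrome_set G (z : syndrome G) a :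
  (a \in syndrome_set z) = (z == syndrome_of G a).
Proof.
apply/idP/eqP => [az|->]; last by rewrite syndrome_set_coset rcoset_refl.
by apply/esym/coset_mem.
Qed.

Lemma syndrome_repr G (z : syndrome G) :
  z = syndrome_of G (repr (syndrome_set z)).
Proof. by apply/eqP; rewrite -mem_syndrome_set; exact: mem_repr_coset. Qed.

Lemma pauli_sign_repr G a g : g \in G ->
  sgn (repr (syndrome_set (syndrome_of G a))) g = sgn a g.
Proof.
move=> gG; have := mem_repr_coset (syndrome_of G a).
rewrite -/(syndrome_set _) {2}syndrome_set_coset => /rcosetP[c /commutantP cG ->].
by rewrite pauli_signDl pauli_sign1 ?mul1r ?cG.
Qed.

Lemma pauli_sign_shift G (z : syndrome G) a g : g \in G ->
  sgn g (repr (syndrome_set (syndrome_shift z a))) =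
    sgn g (repr (syndrome_set z)) * sgn g a.
Proof.
move=> gG; rewrite [in LHS](syndrome_repr z) /syndrome_shift.
rewrite -morphM ?pauli_norm// -/(syndrome_of G _) !(pauli_signC g).
by rewrite pauli_sign_repr// pauli_signDl.
Qed.

(** The class is a translate of the commutant, and the character of [b] is trivial on the commutant
    exactly when [b] lies in the double commutant, which is [G]. *)
Lemma sum_syndrome_set_sign G (z : syndrome G) b :
  \sum_(c in syndrome_set z) sgn c b =
    if b \in G then #|commutant G|%:R * sgn (repr (syndrome_set z)) b else 0.
Proof.
rewrite {1}(syndrome_repr z) syndrome_set_coset; set a := repr _.
rewrite (reindex_inj (addIr a)) /=.
rewrite (eq_bigl (mem (commutant G))) => [|c /=]; last first.
  by rewrite -FinRing.zmodMgE mem_rcoset mulgK.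
under eq_bigr do rewrite pauli_signDl pauli_signC.
rewrite -mulr_suml sum_pauli_sign commutantK.
by case: ifP; rewrite ?mul0r.
Qed.

(** The sign of [g] is constant on each class, so multiplying by the order of the commutant turns
    the sum into one over all labels. *)
Lemma sum_repr_sign G g : g \in G ->
  \sum_(z : syndrome G) sgn (repr (syndrome_set z)) g =
    if g == 0 then #|G|%:R else 0.
Proof.
move=> gG; have C0 : (#|commutant G|%:R : R) != 0
  by rewrite pnatr_eq0 -lt0n cardG_gt0.
apply: (mulfI C0); rewrite mulr_sumr.
transitivity (\sum_a sgn a g).
  rewrite (partition_big (syndrome_of G) xpredT) //=; apply: eq_bigr => z _.
  have := sum_syndrome_set_sign z g; rewrite gG => <-.
  by apply: eq_bigl => a; rewrite mem_syndrome_set eq_sym.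
under eq_bigr do rewrite pauli_signC; rewrite sum_pauli_signT.
by case: ifP => _; rewrite ?mulr0// -natrM mulnC card_commutant natrX.
Qed.

(** Marginalising over the cosets of the commutant discards every Fourier coefficient outside [G].
    What remains is the Fourier transform on [G], and orthogonality over the syndromes kills the
    cross terms. *)
Lemma syndrome_parseval G (u : pauli n -> R) :
  \sum_(z : syndrome G) (\sum_(c in syndrome_set z)
      (4 ^+ n)^-1 * \sum_b sgn c b * u b) ^+ 2
  = #|G|%:R^-1 * \sum_(g in G) u g ^+ 2.
Proof.
have G0 : (#|G|%:R : R) != 0 by rewrite pnatr_eq0 -lt0n cardG_gt0.
have E (z : syndrome G) :
    \sum_(c in syndrome_set z) (4 ^+ n)^-1 * \sum_b sgn c b * u b
    = #|G|%:R^-1 * \sum_(g in G) sgn (repr (syndrome_set z)) g * u g.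
  rewrite -mulr_sumr exchange_big /=.
  under eq_bigr do rewrite -mulr_suml sum_syndrome_set_sign.
  rewrite [in RHS]big_mkcond !mulr_sumr; apply: eq_bigr => g _.
  case: ifP => _; rewrite ?mul0r ?mulr0// !mulrA; congr (_ * _ * _).
  rewrite -natrX -(card_commutant G) natrM invfM mulrAC -mulrA mulfV ?mulr1//.
  by rewrite pnatr_eq0 -lt0n cardG_gt0.
under eq_bigr do rewrite E exprMn [X in _ * X]expr2 big_distrlr /=.
rewrite -mulr_sumr exchange_big /= expr2 -mulrA; congr (_ * _).
rewrite mulr_sumr; apply: eq_bigr => g gG.
rewrite exchange_big /= (bigD1 g) //= [X in _ * (_ + X)]big1 ?addr0; last first.
  move=> h /andP[hG hg].
  under eq_bigr do rewrite mulrACA -pauli_signDr.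
  rewrite -mulr_suml sum_repr_sign ?pauli_groupD//.
  by rewrite addr_eq0 oppr_F2row eq_sym (negPf hg) mul0r.
under eq_bigr do rewrite mulrACA -pauli_signDr addrr_F2row.
by rewrite -mulr_suml sum_repr_sign ?pauli_group0// eqxx mulKf// expr2.
Qed.
End Characters.

(** * Symplectic spreads *)

(* M c is the matrix of the bilinear form (u, v) |-> lam (c u v) on the field with
   2 ^ k elements, where lam is a nonzero linear form to F_2. *)
Lemma exists_symmetric_spread k :
  exists2 M : 'I_(2 ^ k) -> 'M['F_2]_k, forall c, (M c)^T = M c &
    forall x y : 'rV_k, x != 0 -> exists c, y = x *m M c.
Proof.
(* For k = 0 there is no nonzero [x], so any single matrix will do. *)
case: k => [|k].
  by exists (fun=> 0) => [c|x y]; [rewrite trmx0 | rewrite thinmx0 eqxx].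
have [F pcharF cardF] := @pPrimePowerField 2 k.+1 isT isT.
have := pprimeChar_vectAxiom pcharF.
rewrite [#|_|]cardF pfactorK// => -[phi phi_lin [psi phiK psiK]].
(* [E] is the field seen as a vector space over F_2; [phi] and [psi] are mutually inverse coordinate
   maps. *)
set E := pPrimeCharType pcharF in phi phi_lin psi phiK psiK *.
have phiD : {morph phi : u v / u + v}.
  by move=> u v; have := phi_lin 1 u v; rewrite !scale1r.
have phi0 : phi 0 = 0 by apply: (@addrI _ (phi 0)); rewrite -phiD !addr0.
have phiZ a : {morph phi : u / a *: u}.
  by move=> u; rewrite -[a *: u]addr0 phi_lin phi0 addr0.
have phiB u v : phi (u - v) = phi u - phi v.
  by rewrite phiD -[- v]scaleN1r phiZ scaleN1r.
have phi_sum (I : Type) (r : seq I) (P : pred I) (f : I -> E) :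
    phi (\sum_(i <- r | P i) f i) = \sum_(i <- r | P i) phi (f i).
  by apply: (big_morph phi phiD phi0).
have psiD : {morph psi : u v / u + v}.
  by move=> u v; rewrite -[u]psiK -[v]psiK -phiD !phiK.
have psiE x : psi x = \sum_i x 0 i *: psi (delta_mx 0 i).
  apply: (can_inj phiK); rewrite psiK phi_sum [LHS]row_sum_delta.
  by apply: eq_bigr => i _; rewrite phiZ psiK.
(* The first coordinate serves as the nonzero linear form. *)
pose lam (z : E) := phi z 0 0.
pose M (c : E) :=
  \matrix_(i, j) lam (c * psi (delta_mx 0 i) * psi (delta_mx 0 j)) : 'M['F_2]_k.+1.
have ME (c : E) x j : (x *m M c) 0 j = lam (c * psi x * psi (delta_mx 0 j)).
  rewrite mxE (psiE x) mulr_sumr mulr_suml /lam phi_sum summxE.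
  apply: eq_bigr => i _; rewrite !mxE -scalerAr -scalerAl phiZ !mxE.
  by [].
(* If [d] were nonzero, d * psi y would run over the whole field, and [lam] would vanish
   identically. *)
have M_inj (x : 'rV_k.+1) : x != 0 -> injective (fun c => x *m M c).
  move=> x0 c c' /= eqM; pose d := (c - c') * psi x.
  have lam_d y : lam (d * psi y) = 0.
    rewrite (psiE y) mulr_sumr /lam phi_sum summxE big1 // => j _.
    rewrite -scalerAr phiZ mxE /d !mulrBl phiB mxE [X in _ * (_ + X)]mxE.
    have := congr1 (fun u : 'rV_k.+1 => u 0 j) eqM; rewrite !ME /lam => ->.
    by rewrite subrr mulr0.
  have : d == 0.
    apply: contraTT isT => d0; have := lam_d (phi (d^-1 * psi (delta_mx 0 0))).
    by rewrite phiK mulrA mulfV// mul1r /lam psiK mxE !eqxx.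
  rewrite mulf_eq0 subr_eq0 => /orP[/eqP//|/eqP px0].
  by case/eqP: x0; rewrite -[x]psiK px0.
exists (fun c => M (enum_val (cast_ord (esym cardF) c))).
  by move=> c; apply/matrixP => i j; rewrite !mxE mulrAC.
move=> x y x0.
(* An injective map between finite sets of equal size is onto. *)
have : y \in codom (fun c => x *m M c).
  apply: inj_card_onto (M_inj x x0) _ _.
  by rewrite card_mx card_Fp// mul1n [leqRHS]cardF.
case/codomP => c ->; exists (cast_ord cardF (enum_rank c)).
by rewrite cast_ordK enum_rankK.
Qed.

(** * Symplectic coordinates and coverings by stabilizer groups *)

Section Isotropic.
Variable n : nat.
Implicit Types (a b c g : pauli n) (G H S : {group pauli n}).

Lemma sympZl (x : 'F_2) a b : symp (x *: a) b = x * symp a b.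
Proof.
by case/orP: (F2_cases x) => /eqP ->; rewrite ?scale0r ?scale1r ?symp0 ?mul0r ?mul1r.
Qed.

Lemma sympZr (x : 'F_2) a b : symp a (x *: b) = x * symp a b.
Proof. by rewrite sympC sympZl sympC. Qed.

Lemma pauli_groupZ G (x : 'F_2) a : a \in G -> x *: a \in G.
Proof.
by case/orP: (F2_cases x) => /eqP ->; rewrite ?scale0r ?scale1r ?pauli_group0.
Qed.

Section Kernel.
Variables (V : zmodType) (f : pauli n -> V) (fD : {morph f : a b / a + b}).
Variable G : {group pauli n}.

Definition kernel_set := [set g in G | f g == 0].

Lemma kernel_group_set : group_set kernel_set.
Proof.
have f0 : f 0 = 0 by apply: (@addrI _ (f 0)); rewrite -fD !addr0.
apply/group_setP; split; first by rewrite inE group1 /= f0.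
move=> a b; rewrite !inE => /andP[aG /eqP fa] /andP[bG /eqP fb].
by rewrite groupM //= fD fa fb addr0.
Qed.
Canonical kernel_group := Group kernel_group_set.
End Kernel.

(** Symplectic Gram-Schmidt, by induction on the order of [G]. If the form vanishes on [G], then k =
    0. Otherwise a pair [a], [b] with symp a b = 1 is split off and the induction continues with its
    orthogonal complement [G'] in [G]. *)
Lemma exists_symplectic_coordinates G :
  exists k (al be : pauli n -> 'rV['F_2]_k),
    [/\ {morph al : a b / a + b}, {morph be : a b / a + b},
        {in G &, forall g h, symp g h = (al g *m (be h)^T + be g *m (al h)^T) 0 0} &
        #|G| = (4 ^ k * #|G :&: commutant G|)%N].
Proof.
have [m] := ubnP #|G|; elim: m G => // m IH G; rewrite ltnS => leGm.
have [/stabilizerP Giso|] := boolP (stabilizer_group G).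
  exists 0%N, (fun=> 0), (fun=> 0); split => [a b|a b|g h gG hG|]; rewrite ?addr0//.
    by rewrite Giso// !mul0mx addr0 mxE.
  rewrite mul1n; congr #|pred_of_set _|; apply/esym/setIidPl/subsetP => g gG.
  by apply/commutantP => h hG; rewrite Giso.
rewrite negb_forall_in => /exists_inP[a aG].
rewrite negb_forall_in => /exists_inP[b bG ab0].
have {ab0} ab : symp a b = 1.
  by case/orP: (F2_cases (symp a b)) ab0 => /eqP ->.
have ba : symp b a = 1 by rewrite sympC.
pose f g : 'F_2 * 'F_2 := (symp g a, symp g b).
have fD : {morph f : g h / g + h} by move=> g h; rewrite /f !sympDl.
pose G' : {group pauli n} := kernel_group fD G.
have G'P g : reflect [/\ g \in G, symp g a = 0 & symp g b = 0] (g \in G').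
  rewrite inE; apply: (iffP andP) => [[gG /eqP[-> ->]] //|[gG ga gb]].
  by rewrite gG /f ga gb.
(* The projection of [G] onto [G'] along the span of [a] and [b]. *)
pose pi g := g + symp g b *: a + symp g a *: b.
have piD : {morph pi : g h / g + h}.
  move=> g h; rewrite /pi !sympDl !scalerDl.
  by rewrite [RHS]addrACA [in RHS](addrACA g).
have piE g : g = pi g + (symp g b *: a + symp g a *: b).
  by rewrite /pi -(addrA g) -addrA addrr_F2row addr0.
have pia g : symp (pi g) a = 0.
  by rewrite /pi sympDl sympDl !sympZl sympp ba mulr0 mulr1 addr0 addrr_F2.
have pib g : symp (pi g) b = 0.
  by rewrite /pi sympDl sympDl !sympZl sympp ab mulr0 mulr1 addr0 addrr_F2.
have piG g : g \in G -> pi g \in G'.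
  by move=> gG; apply/G'P; split; rewrite ?pia ?pib// !pauli_groupD ?pauli_groupZ.
clearbody pi.
have sympE g h : symp g h =
    symp (pi g) (pi h) + (symp g b * symp h a + symp g a * symp h b).
  pose v k := symp k b *: a + symp k a *: b.
  have uv k l : symp (pi k) (v l) = 0.
    by rewrite /v sympDr !sympZr pia pib !mulr0 addr0.
  have vv : symp (v g) (v h) = symp g b * symp h a + symp g a * symp h b.
    rewrite /v sympDl !sympZl !sympDr !sympZr (sympp a) (sympp b) ab ba.
    have expand (K : comPzRingType) (s t u w : K) :
      s * (u * 0 + w * 1) + t * (u * 1 + w * 0) = s * w + t * u by ring.
    exact: expand.
  rewrite {1}(piE g) {1}(piE h) -/(v g) -/(v h); clearbody v.
  by rewrite sympDl sympDr uv addr0 (sympC (v g)) sympDl uv add0r (sympC (v h)) vv.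
(* [f] maps [G] onto the four pairs, and its fibre over (s, t) is the translate of [G'] by [c]. *)
have cardG : #|G| = (4 * #|G'|)%N.
  have card4 : #|{: 'F_2 * 'F_2}| = 4%N by rewrite card_prod card_Fp.
  rewrite -sum1_card (partition_big f xpredT) //= -card4 -sum_nat_const.
  apply: eq_bigr => -[s t] _; pose c := s *: b + t *: a.
  have cG : c \in G by rewrite pauli_groupD ?pauli_groupZ.
  have fc : f c = (s, t).
    by rewrite /f !sympDl !sympZl !sympp ab ba !mulr0 !mulr1 addr0 add0r.
  rewrite sum1_card -[RHS](card_imset _ (addrI c)); apply: eq_card => g.
  rewrite unfold_in /=; apply/andP/imsetP => [[gG /eqP fg]|[h /G'P[hG ha hb] ->]].
    exists (c + g); last by rewrite addrA addrr_F2row add0r.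
    by rewrite inE pauli_groupD//= fD fc fg; apply/eqP; congr (_, _); exact: addrr_F2.
  by split; [exact: pauli_groupD | rewrite fD fc /f ha hb /= !addr0].
(* An element orthogonal to [G'], to [a] and to [b] is orthogonal to [G], so splitting off the pair
   keeps the radical. *)
have radG : G' :&: commutant G' = G :&: commutant G.
  apply/setP => g; apply/setIP/setIP => -[].
    move=> /G'P[gG ga gb] /commutantP gG'; split=> //; apply/commutantP => h hG.
    rewrite sympC (piE h) !sympDl !sympZl (sympC (pi h)) gG' ?piG//.
    rewrite (sympC a g) (sympC b g).
    by rewrite ga gb !mulr0 !addr0.
  move=> gG /commutantP gC; split; first by apply/G'P; rewrite !gC.
  by apply/commutantP => h /G'P[hG _ _]; rewrite gC.
have [|k [al [be [alD beD alE cardG']]]] := IH G'.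
  apply: leq_trans leGm; rewrite cardG -[ltnLHS]mul1n ltn_mul2r cardG_gt0 //.
(* The new coordinates are the coefficients of [g] along [a] and [b]; they contribute the last two
   terms of [sympE]. *)
exists (1 + k)%N, (fun g => row_mx (symp g b)%:M (al (pi g))),
  (fun g => row_mx (symp g a)%:M (be (pi g))); split=> [g h|g h|g h gG hG|].
- by rewrite piD alD sympDl raddfD /= add_row_mx.
- by rewrite piD beD sympDl raddfD /= add_row_mx.
- rewrite !tr_row_mx !mul_row_col addrACA mxE sympE addrC; congr (_ + _).
    by rewrite alE ?piG.
  by rewrite !tr_scalar_mx -!scalar_mxM -raddfD mxE eqxx mulr1n.
by rewrite expnS -mulnA -radG -cardG' cardG.
Qed.

(** The groups are given by al = 0 and by be = al M_c. Symmetry of [M c] makes them isotropic, and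
    the spread property finds a suitable [c] for every element with nonzero [al]. *)
Lemma isotropic_cover G :
  exists k (H : 'I_(2 ^ k).+1 -> {group pauli n}),
    [/\ forall i, stabilizer_group (H i), {in G, forall g, exists i, g \in H i} &
        #|G| = (4 ^ k * #|G :&: commutant G|)%N].
Proof.
have [k [al [be [alD beD sympE cardG]]]] := exists_symplectic_coordinates G.
have [M symM coverM] := exists_symmetric_spread k.
pose f j g := be g - al g *m M j.
have fD j : {morph f j : a b / a + b}.
  by move=> a b; rewrite /f alD beD mulmxDl opprD addrACA.
(* Index 0 stands for the group al = 0, the others for the 2^k matrices. *)
exists k, (fun i => if unlift ord0 i is Some c then kernel_group (fD c) G
                    else kernel_group alD G); split=> // [i|g gG].
  case: (unlift ord0 i) => [c|]; apply/stabilizerP => a b; rewrite !inE.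
    move=> /andP[aG]; rewrite subr_eq0 => /eqP ea /andP[bG]; rewrite subr_eq0 => /eqP eb.
    by rewrite sympE// ea eb trmx_mul symM mulmxA mxE addrr_F2.
  move=> /andP[aG /eqP ea] /andP[bG /eqP eb].
  by rewrite sympE// ea eb trmx0 mul0mx mulmx0 addr0 mxE.
have [a0|a0] := eqVneq (al g) 0.
  by exists ord0; rewrite unlift_none inE gG a0 eqxx.
have [c be_c] := coverM _ (be g) a0.
by exists (lift ord0 c); rewrite liftK inE gG /f -be_c subrr eqxx.
Qed.

(** The radical of [G] is itself an admissible subgroup and contains every other one. *)
Lemma maximal_stabilizerE S G :
  maximal_stabilizer_subgroup S G -> S :=: G :&: commutant G.
Proof.
case/maxgroupP => /and3P[SG _ SC] maxS; apply/esym.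
apply: (maxS (G :&: commutant G)%G); last by rewrite subsetI SG.
rewrite subsetIl subsetIr andbT /=; apply/stabilizerP => a b /setIP[_ /commutantP aC].
by case/setIP=> bG _; rewrite aC.
Qed.
End Isotropic.

(** * Positive semidefinite matrices *)

Section Psd.
Variable R : realType.
Local Notation C := R[i].

Lemma adjmxM m n p (A : 'M[C]_(m, n)) (B : 'M[C]_(n, p)) :
  (A *m B)^t* = B^t* *m A^t*.
Proof. by rewrite trmx_mul map_mxM. Qed.

Lemma adjmxD m n (A B : 'M[C]_(m, n)) : (A + B)^t* = A^t* + B^t*.
Proof. by rewrite linearD map_mxD. Qed.

Lemma adjmxZ m n c (A : 'M[C]_(m, n)) : (c *: A)^t* = c^* *: A^t*.
Proof. by rewrite linearZ map_mxZ. Qed.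

Lemma adjmx1 n : (1%:M : 'M[C]_n)^t* = 1%:M.
Proof. by rewrite trmx1 map_mx1. Qed.

Lemma adjmx_delta m n i j : (delta_mx i j : 'M[C]_(m, n))^t* = delta_mx j i.
Proof. by rewrite trmx_delta map_delta_mx. Qed.

Lemma form_delta m (A : 'M[C]_m) i j :
  ((delta_mx i 0 : 'cV_m)^t* *m A *m (delta_mx j 0 : 'cV_m)) 0 0 = A i j.
Proof. by rewrite adjmx_delta -mulmxA -colE -rowE !mxE. Qed.

(** Polarisation: the vectors e_i + c e_j with c = 1 and c = i separate [A i j] from [A j i]. *)
Lemma form_eq0 m (A : 'M[C]_m) :
  (forall u : 'cV_m, (u^t* *m A *m u) 0 0 = 0) -> A = 0.
Proof.
move=> A0; apply/matrixP => i j; rewrite mxE.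
have polar c : c * A i j + c^* * A j i = 0.
  have := A0 (delta_mx i 0 + c *: delta_mx j 0).
  rewrite adjmxD adjmxZ !mulmxDl !mulmxDr -!scalemxAl -!scalemxAr.
  rewrite mxE [X in X + _]mxE [X in _ + X]mxE (A0 (delta_mx i 0)) add0r.
  rewrite [X in _ + (_ + X)]mxE [X in _ + (_ + _ * X)]mxE.
  rewrite (A0 (delta_mx j 0)) !mulr0 addr0.
  by rewrite mxE form_delta [X in _ + X]mxE form_delta.
have := polar 1; have := polar 'i; rewrite conjCi conjC1 !mul1r mulNr.
move=> /eqP; rewrite subr_eq0 => /eqP /(mulfI (neq0Ci _)) -> /eqP.
by rewrite -mulr2n mulrn_eq0 => /eqP.
Qed.

(** The form of [A] minus its adjoint is a real number minus its own conjugate. *)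
Lemma psd_adj m (A : 'M[C]_m) : psd A -> A^t* = A.
Proof.
move=> Apsd; apply/eqP; rewrite -subr_eq0; apply/eqP/form_eq0 => u.
rewrite mulmxBr mulmxBl mxE [X in _ + X]mxE.
have -> : u^t* *m A^t* *m u = (u^t* *m A *m u)^t*.
  by rewrite !adjmxM trmxCK mulmxA.
rewrite mxE mxE (CrealP _) ?subrr//; exact: ger0_real.
Qed.

Lemma psd_gram m p (A : 'M[C]_(p, m)) : psd (A^t* *m A).
Proof.
move=> u; rewrite mulmxA -mulmxA -adjmxM mxE; apply: sumr_ge0 => i _.
by rewrite !mxE mulrC mul_conjC_ge0.
Qed.

Lemma psd1 m : psd (1%:M : 'M[C]_m).
Proof. by have := psd_gram (1%:M : 'M[C]_m); rewrite adjmx1 mul1mx. Qed.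

Lemma psd_conj m p (B : 'M[C]_(p, m)) (A : 'M[C]_m) :
  psd A -> psd (B *m A *m B^t*).
Proof.
move=> Apsd u; have := Apsd (B^t* *m u).
by rewrite adjmxM trmxCK !mulmxA.
Qed.

Lemma psd_diag m (A : 'M[C]_m) i : psd A -> 0 <= A i i.
Proof. by move=> Apsd; rewrite -form_delta. Qed.

(** In an eigenbasis of [A] the trace is the sum of eigenvalues of [A] times diagonal entries of the
    conjugated [B], all nonnegative. *)
Lemma hs_psd_ge0 m (A B : 'M[C]_m) : psd A -> psd B -> 0 <= hs A B.
Proof.
move=> Apsd Bpsd; rewrite /hs psd_adj//.
have Aherm : A \is hermsymmx.
  by apply/is_hermitianmxP; rewrite expr0 scale1r psd_adj.
have /orthomx_spectralP := hermitian_normalmx Aherm.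
set P := spectralmx A; set d := spectral_diag A.
have Punit : P \is unitarymx by exact: spectral_unitarymx.
rewrite invmx_unitary// => AE.
have PP : P *m P^t* = 1%:M by apply/unitarymxP.
have dE : P *m A *m P^t* = diag_mx d.
  by rewrite AE !mulmxA PP mul1mx -mulmxA PP mulmx1.
have d_ge0 i : 0 <= d 0 i.
  have := psd_diag i (psd_conj P Apsd).
  by rewrite dE mxE eqxx mulr1n.
have cycle (Q D M : 'M[C]_m) :
    \tr (Q *m D *m M *m B) = \tr (D *m (M *m B *m Q)).
  by rewrite -!mulmxA mxtrace_mulC !mulmxA.
rewrite AE cycle.
apply: sumr_ge0 => i _; rewrite mul_diag_mx mxE mulr_ge0//.
exact: psd_diag (psd_conj P Bpsd).
Qed.

(** Complete positivity at k = 1, where [blockE] identifies a matrix with its single block. *)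
Lemma psd_completely_positive m (Lam : 'M[C]_m -> 'M[C]_m) (A : 'M[C]_m) :
  completely_positive Lam -> psd A -> psd (Lam A).
Proof.
move=> cp Apsd.
have blockE (B : 'M[C]_m) (u : 'cV_m) : u^t* *m B *m u =
    (\mxcol_(_ < 1) u)^t* *m \mxblock_(i < 1, j < 1) B *m \mxcol_(_ < 1) u.
  have -> : (\mxcol_(_ < 1) u)^t* = \mxrow_(_ < 1) u^t*.
    by rewrite tr_mxcol; apply/matrixP => i j; rewrite !mxE.
  rewrite mul_mxrow_mxblock.
  by rewrite mul_mxrow_mxcol big_ord1 big_ord1.
have /cp Bpsd : psd (\mxblock_(i < 1, j < 1) A).
  move=> u; rewrite -[u]submxcolK.
  have -> : \mxcol_(i < 1) submxcol u i = \mxcol_(i < 1) (submxcol u ord0 : 'cV_m).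
    by apply/eq_mxcolP => i; rewrite (ord1 i).
  by rewrite -blockE.
by move=> u; rewrite blockE.
Qed.

Lemma hsD m (A B D : 'M[C]_m) : hs A (B + D) = hs A B + hs A D.
Proof. by rewrite /hs mulmxDr mxtraceD. Qed.

Lemma hsZ m c (A B : 'M[C]_m) : hs A (c *: B) = c * hs A B.
Proof. by rewrite /hs -scalemxAr mxtraceZ. Qed.

End Psd.

(** * Pauli matrices and twirling *)

Section PauliMatrices.
Variables (R : realType) (n : nat).
Local Notation C := R[i].
Local Notation op := 'M[C]_(qdim n).
Implicit Types (a h : pauli n) (v w : 'rV['F_2]_n) (x y : 'I_(qdim n)).

Lemma adjmxE p m (A : 'M[C]_(p, m)) i j : A^t* i j = (A j i)^*.
Proof. by rewrite !mxE. Qed.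

(** * Bit strings, translations and signs *)

Definition basis_label x : 'rV['F_2]_n := \row_k (qbits x k : 'F_2).

Definition label_basis v : 'I_(qdim n) := enum_rank [ffun k => v 0 k : 'I_2].

Lemma basis_labelK : cancel basis_label label_basis.
Proof.
move=> x; apply: (canLR (@enum_valK _)); apply/ffunP => k.
by rewrite ffunE mxE.
Qed.

Lemma label_basisK : cancel label_basis basis_label.
Proof. by move=> v; apply/rowP => k; rewrite mxE /qbits enum_rankK ffunE. Qed.

(** The permutation of the basis by X[v]. *)
Definition flip v x := label_basis (basis_label x + v).

Lemma basis_label_flip v x : basis_label (flip v x) = basis_label x + v.
Proof. exact: label_basisK. Qed.

Lemma eq_flip v x y : (basis_label x == basis_label y + v) = (x == flip v y).
Proof. by rewrite -basis_label_flip (can_eq basis_labelK). Qed.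

Lemma flipC v w x : flip v (flip w x) = flip w (flip v x).
Proof. by rewrite /flip !label_basisK addrAC. Qed.

Lemma flipK v : involutive (flip v).
Proof. by move=> x; rewrite /flip label_basisK -addrA addrr_F2row addr0 basis_labelK. Qed.

Lemma eq_flipC v x y : (x == flip v y) = (y == flip v x).
Proof. by apply/eqP/eqP => ->; rewrite flipK. Qed.

(** The eigenvalue of Z[w] at the basis vector with bits [v]. The ring is a parameter because signs
    in [R] and in [C] have to be compared. *)
Definition chi (K : comNzRingType) w v : K := \prod_k (-1) ^+ (w 0%R k * v 0%R k)%N.

Lemma chiDr (K : comNzRingType) w v v' : chi K w (v + v') = chi K w v * chi K w v'.
Proof.
rewrite -big_split; apply: eq_bigr => k _ /=; rewrite mxE.
case/orP: (F2_cases (w 0 k)) => /eqP ->; first by rewrite !mul0n mul1r.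
case/orP: (F2_cases (v 0 k)) => /eqP ->; case/orP: (F2_cases (v' 0 k)) => /eqP -> /=;
  by rewrite ?muln0 ?muln1 ?expr0 ?expr1 ?mulr1 ?mul1r ?mulrNN ?mulr1.
Qed.

Lemma chiC (K : comNzRingType) w v : chi K w v = chi K v w.
Proof. by apply: eq_bigr => k _; rewrite mulnC. Qed.

Lemma chi_exp (K : comNzRingType) w v :
  chi K w v = (-1) ^+ (\sum_k w 0%R k * v 0%R k)%N.
Proof. by rewrite /chi -expr_sum. Qed.

Lemma chi2 (K : comNzRingType) w v : chi K w v * chi K w v = 1.
Proof. by rewrite chi_exp -expr2 sqrr_sign. Qed.

Lemma chi_conj w v : (chi C w v)^* = chi C w v.
Proof. by rewrite chi_exp rmorphXn rmorphN1. Qed.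

Lemma pauli_sign_chi a b :
  pauli_sign R a b = chi R (xpart a) (zpart b) * chi R (zpart a) (xpart b).
Proof.
have dotE w v : (-1) ^+ ((w *m v^T) 0 0 : 'F_2) = chi R w v.
  rewrite mxE (big_morph (fun u : 'F_2 => (-1) ^+ u : R) (@signrF2 R) erefl).
  apply: eq_bigr => k _; rewrite mxE.
  by case/orP: (F2_cases (w 0 k)) => /eqP ->; case/orP: (F2_cases (v 0 k)) => /eqP ->.
by rewrite /pauli_sign /symp mxE signrF2 !dotE.
Qed.

Lemma chi_real w v : (chi R w v)%:C%C = chi C w v.
Proof. by rewrite !chi_exp rmorphXn rmorphN1. Qed.

Lemma sum_chi w : \sum_v chi C w v = if w == 0 then (2 ^ n)%:R else 0.
Proof.
case: eqP => [->|/eqP w0].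
  rewrite (eq_bigr (fun=> 1)) => [|v _]; last first.
    by rewrite chi_exp big1 // => k _; rewrite mxE mul0n.
  by rewrite sumr_const card_mx card_Fp// mul1n.
have [k wk] : exists k, w 0 k == 1.
  apply/existsP; apply: contraNT w0; rewrite negb_exists => /forallP w0.
  apply/eqP/rowP => k; rewrite mxE.
  by have := w0 k; case/orP: (F2_cases (w 0 k)) => /eqP ->.
have chik : chi C w (delta_mx 0 k) = -1.
  rewrite /chi (bigD1 k) //= big1 => [|j jk]; rewrite mxE eqxx ?eqxx.
    by rewrite (eqP wk) mulr1 expr1.
  by rewrite (negPf jk) muln0.
have : \sum_v chi C w v = - \sum_v chi C w v.
  rewrite {1}(reindex_inj (addrI (delta_mx 0 k))) -mulN1r -chik mulr_sumr /=.
  by apply: eq_bigr => v _; rewrite chiDr.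
by move/eqP; rewrite -addr_eq0 -mulr2n mulrn_eq0 => /eqP.
Qed.

Lemma sigmaX_expE (b i j : 'F_2) : (sigmaX R ^+ b) i j = (i == j + b)%:R.
Proof.
case/orP: (F2_cases b) => /eqP ->; rewrite ?expr0 ?expr1 mxE ?addr0 //.
by case/orP: (F2_cases i) => /eqP ->; case/orP: (F2_cases j) => /eqP ->.
Qed.

Lemma sigmaZ_expE (b i j : 'F_2) :
  (sigmaZ R ^+ b) i j = (i == j)%:R * (-1) ^+ (b * j)%N.
Proof.
case/orP: (F2_cases b) => /eqP ->; rewrite ?expr0 ?expr1 mxE ?mulr1 ?mul1n //.
by case: eqP => [->|_]; rewrite ?mul1r ?mul0r.
Qed.

Lemma prod_eq_row v w : \prod_k (v 0 k == w 0 k)%:R = (v == w)%:R :> C.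
Proof.
case: eqP => [->|/eqP vw]; first by rewrite big1 // => k _; rewrite eqxx.
have [k vwk] : exists k, v 0 k != w 0 k.
  apply/existsP; apply: contraNT vw; rewrite negb_exists => /forallP vw.
  by apply/eqP/rowP => k; apply/eqP; rewrite -[_ == _]negbK.
by rewrite (bigD1 k) //= (negPf vwk) mul0r.
Qed.

Lemma tensor_powXE v x y : tensor_pow (sigmaX R) v x y = (x == flip v y)%:R.
Proof.
rewrite mxE -eq_flip -prod_eq_row; apply: eq_bigr => k _.
by rewrite !mxE -sigmaX_expE.
Qed.

Lemma tensor_powZE w x y :
  tensor_pow (sigmaZ R) w x y = (x == y)%:R * chi C w (basis_label y).
Proof.
rewrite mxE -(can_eq basis_labelK) -prod_eq_row -big_split; apply: eq_bigr => k _ /=.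
by rewrite !mxE -sigmaZ_expE.
Qed.

(** * Entries of Pauli matrices and of conjugations by them *)

Definition pauli_phase a : C :=
  'i ^+ (\sum_(k < n) (xpart a 0%R k * zpart a 0%R k))%N.

Lemma pauli_phaseK a : pauli_phase a * (pauli_phase a)^* = 1.
Proof.
by rewrite /pauli_phase rmorphXn -exprMn /= conjCi mulrN -expr2 sqrCi opprK expr1n.
Qed.

Lemma pauli_mxE a x y : pauli_mx R a x y =
  pauli_phase a * ((x == flip (xpart a) y)%:R * chi C (zpart a) (basis_label y)).
Proof.
rewrite mxE; congr (_ * _); rewrite mxE (bigD1 y) //= big1 => [|z zy].
  by rewrite addr0 tensor_powXE tensor_powZE eqxx mul1r.
by rewrite tensor_powZE (negPf zy) mul0r mulr0.
Qed.

(** The phase cancels against its conjugate, and the two signs that come from [xpart a] cancel each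
    other. *)
Lemma pauli_gateE a (M : op) x y : pauli_gate a M x y =
  chi C (zpart a) (basis_label x + basis_label y) *
  M (flip (xpart a) x) (flip (xpart a) y).
Proof.
have mulP (B : op) s t : (pauli_mx R a *m B) s t =
    pauli_phase a * chi C (zpart a) (basis_label s + xpart a) * B (flip (xpart a) s) t.
  rewrite mxE (bigD1 (flip (xpart a) s)) //= big1 => [|z zs].
    by rewrite pauli_mxE flipK eqxx mul1r basis_label_flip addr0.
  by rewrite pauli_mxE eq_flipC (negPf zs) mul0r mulr0 mul0r.
have mulPt (B : op) s t : (B *m (pauli_mx R a)^t*) s t =
    (pauli_phase a)^* * chi C (zpart a) (basis_label t + xpart a) * B s (flip (xpart a) t).
  rewrite mxE (bigD1 (flip (xpart a) t)) //= big1 => [|z zt].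
    rewrite adjmxE pauli_mxE !rmorphM /= conjC_nat chi_conj flipK eqxx mul1r.
    by rewrite basis_label_flip addr0 mulrC.
  by rewrite adjmxE pauli_mxE eq_flipC (negPf zt) mul0r mulr0 rmorph0 mulr0.
rewrite /pauli_gate mulPt mulP.
transitivity (pauli_phase a * (pauli_phase a)^* *
    (chi C (zpart a) (basis_label x + xpart a) * chi C (zpart a) (basis_label y + xpart a))
    * M (flip (xpart a) x) (flip (xpart a) y)).
  by ring.
by rewrite pauli_phaseK mul1r -chiDr addrACA addrr_F2row addr0.
Qed.

Lemma pauli_gate1 a : pauli_gate a (1%:M : op) = 1%:M.
Proof.
apply/matrixP => x y; rewrite pauli_gateE !mxE (can_eq (flipK _)).
case: eqP => [->|_]; rewrite ?mulr0// addrr_F2row mulr1 chi_exp big1 // => k _.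
by rewrite !mxE muln0.
Qed.

Lemma pauli_mx_unitary a : pauli_mx R a *m (pauli_mx R a)^t* = 1%:M.
Proof. by have := pauli_gate1 a; rewrite /pauli_gate mulmx1. Qed.

Lemma pauli_gate_trace a (M : op) : \tr (pauli_gate a M) = \tr M.
Proof.
by rewrite /pauli_gate mxtrace_mulC mulmxA (mulmx1C (pauli_mx_unitary a)) mul1mx.
Qed.

Lemma pauli_gate_psd a (M : op) : psd M -> psd (pauli_gate a M).
Proof. exact: psd_conj. Qed.

(** Conjugating the phase i^(a_x . a_z) gives the sign (-1)^(a_x . a_z), which is also the sign of
    moving X[a_x] past Z[a_z]. *)
Lemma pauli_mx_adj a : (pauli_mx R a)^t* = pauli_mx R a.
Proof.
apply/matrixP => x y; rewrite adjmxE !pauli_mxE.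
rewrite !rmorphM /= conjC_nat chi_conj eq_flipC.
case: eqP => [->|_]; rewrite ?mul0r ?mulr0// !mul1r basis_label_flip chiDr.
have -> : (pauli_phase a)^* = pauli_phase a * chi C (zpart a) (xpart a).
  rewrite /pauli_phase chiC chi_exp rmorphXn /= conjCi.
  by rewrite -exprMn mulrN1.
by rewrite mulrACA chi2 mulr1.
Qed.

Lemma pauli_mx0 : pauli_mx R (0 : pauli n) = 1%:M.
Proof.
apply/matrixP => x y; rewrite pauli_mxE mxE /pauli_phase /xpart /zpart !linear0.
rewrite /flip addr0 basis_labelK chi_exp !big1 ?expr0 ?mul1r ?mulr1 // => k _;
  by rewrite mxE.
Qed.

Lemma card_qdim_neq0 : (qdim n)%:R != 0 :> C.
Proof. by rewrite qdimE pnatr_eq0 expn_eq0. Qed.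

Lemma hs_pauli_vec h (M : op) :
  hs (pauli_vec R h) M *: pauli_vec R h =
    (qdim n)%:R^-1 *: (hs (pauli_mx R h) M *: pauli_mx R h).
Proof.
rewrite /pauli_vec {1}/hs adjmxZ -scalemxAl mxtraceZ -/(hs _ _).
rewrite [LHS]scalerA [RHS]scalerA; congr (_ *: _).
have -> : ((sqrtC (qdim n)%:R)^-1)^* = (sqrtC (qdim n)%:R)^-1 :> C.
  by rewrite fmorphV /= (CrealP _)// ger0_real// sqrtC_ge0.
by rewrite mulrAC -invfM -expr2 sqrtCK mulrC.
Qed.

(** Twirling against the character of [h] projects on the line of the Pauli matrix [h]: the Z parts
    of [a] select the matrix entries, and the X parts assemble the trace. *)
Lemma pauli_twirl h (M : op) :
  \sum_a (pauli_sign R h a)%:C%C *: pauli_gate a M =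
    (4 ^ n)%:R *: (hs (pauli_vec R h) M *: pauli_vec R h).
Proof.
rewrite hs_pauli_vec scalerA.
have -> : (4 ^ n)%:R * (qdim n)%:R^-1 = (2 ^ n)%:R :> C.
  by rewrite qdimE (_ : 4 = 2 * 2)%N// expnMn natrM mulfK// pnatr_eq0 expn_eq0.
apply/matrixP => x y; rewrite summxE mxE [X in _ = _ * X]mxE.
transitivity (\sum_v \sum_w chi C (zpart h) v * M (flip v x) (flip v y) *
    chi C w (xpart h + (basis_label x + basis_label y))).
  rewrite pair_big /=.
  rewrite (reindex (fun a : pauli n => (xpart a, zpart a))) /=; last first.
    exists (fun p => row_mx p.1 p.2) => [a|[v w]] _.
      exact: hsubmxK.
    by rewrite /= /xpart /zpart row_mxKl row_mxKr.
  apply: eq_bigr => a _; rewrite mxE pauli_gateE pauli_sign_chi rmorphM /= !chi_real.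
  rewrite !chiDr (chiC _ (xpart h)).
  by ring.
(* The sum over [w], the Z part of [a], vanishes unless [x] and [y] differ by the X part of [h]. *)
under eq_bigr => v _.
  rewrite -mulr_sumr; under eq_bigr do rewrite chiC.
  rewrite sum_chi; over.
have -> : (xpart h + (basis_label x + basis_label y) == 0) = (x == flip (xpart h) y).
  by rewrite -eq_flip -[in RHS]subr_eq0 oppr_F2row addrC addrA.
rewrite pauli_mxE; case: eqP => [->|_]; last first.
  by rewrite mul0r !mulr0 big1 // => v _; rewrite mulr0.
(* The remaining sum over [v] is the trace, with the basis listed as the flips of [y]. *)
have -> : hs (pauli_mx R h) M = (pauli_phase h)^* *
    \sum_v chi C (zpart h) (basis_label y + v) * M (flip v (flip (xpart h) y)) (flip v y).
  rewrite mulr_sumr /hs /mxtrace (reindex (fun v => flip v y)) /=; last first.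
    exists (fun u => basis_label u + basis_label y) => [v|u] _.
      by rewrite basis_label_flip addrAC addrr_F2row add0r.
    by rewrite /flip addrC -addrA addrr_F2row addr0 basis_labelK.
  apply: eq_bigr => v _; set u := flip v y.
  rewrite mxE (bigD1 (flip (xpart h) u)) //= big1 => [|s su].
    rewrite adjmxE pauli_mxE eqxx mul1r addr0 rmorphM /= chi_conj basis_label_flip.
    by rewrite -mulrA /u (flipC v).
  by rewrite adjmxE pauli_mxE (negPf su) mul0r mulr0 conjC0 mul0r.
rewrite mul1r -mulr_suml mulrC; congr (_ * _).
rewrite mulrACA [_^* * _]mulrC pauli_phaseK mul1r mulr_suml; apply: eq_bigr => v _.
rewrite chiDr -{1}[chi C _ v]mul1r -{1}(chi2 _ (zpart h) (basis_label y)).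
by ring.
Qed.

End PauliMatrices.

(** * Statistics of one run *)

Lemma big_tuple_rcons (V : nmodType) (T : finType) k (F : seq T -> V) :
  \sum_(a : k.+1.-tuple T) F a = \sum_(a : k.-tuple T) \sum_x F (rcons a x).
Proof.
rewrite pair_big /= (reindex (fun p : k.-tuple T * T => rcons_tuple p.1 p.2)) //=.
apply/onW_bij/inj_card_bij; last by rewrite card_prod !card_tuple expnSr.
move=> [a x] [b y] /(congr1 val) /= /rcons_inj[ab ->].
by congr (_, _); apply: val_inj.
Qed.

Section ComplexRe.
Variable R : realType.
Implicit Types z : R[i].

Lemma Re_realM (r : R) z : complex.Re (r%:C%C * z) = r * complex.Re z.
Proof. by case: z => a b; rewrite /= mul0r subr0. Qed.

Lemma Re_sum (I : Type) (s : seq I) (P : pred I) (F : I -> R[i]) :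
  complex.Re (\sum_(i <- s | P i) F i) = \sum_(i <- s | P i) complex.Re (F i).
Proof. by apply: (big_morph _ _ erefl) => -[a b] [c d]. Qed.

Lemma Re_ge0 z : 0 <= z -> 0 <= complex.Re z.
Proof. by rewrite lecE => /andP[]. Qed.
End ComplexRe.

Section Runs.
Variables (R : realType) (n : nat) (N : noise R n).
Local Notation C := R[i].
Local Notation op := 'M[C]_(qdim n).
Hypothesis Ngtm : gtm N.
Implicit Types (a h : pauli n) (H : {group pauli n}) (M : op).

Let cp : completely_positive (chan N). Proof. by case: Ngtm. Qed.
Let tp : trace_preserving (chan N). Proof. by case: Ngtm. Qed.

Let chanZ c M : chan N (c *: M) = c *: chan N M. Proof. exact: linearZ. Qed.

Lemma pauli_gate_sum (I : finType) a (c : I -> C) (F : I -> op) :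
  pauli_gate a (\sum_i c i *: F i) = \sum_i c i *: pauli_gate a (F i).
Proof.
rewrite /pauli_gate mulmx_sumr mulmx_suml; apply: eq_bigr => i _.
by rewrite -scalemxAr -scalemxAl.
Qed.

(** [P] is the difference of the positive matrices 1 + P and 1, and [chan N] preserves positivity,
    so all overlaps involved are real. *)
Lemma pauli_vec_eigenvalue h :
  hs (pauli_vec R h) (chan N (pauli_vec R h)) = (pauli_eigenvalue N h)%:C%C.
Proof.
rewrite /pauli_eigenvalue RRe_real//.
set P := pauli_mx R h; set s := (sqrtC (qdim n)%:R)^-1 : C.
have s_real : s \is Num.real.
  by apply: ger0_real; rewrite invr_ge0 sqrtC_ge0.
rewrite /pauli_vec -/P -/s chanZ hsZ /hs adjmxZ -scalemxAl mxtraceZ (CrealP s_real).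
rewrite !rpredM// -/(hs P _).
have Qpsd : psd (1%:M + P).
  (* [P] squares to 1, so (1 + P)^2 = 2 (1 + P). *)
  have -> : 1%:M + P = 2^-1 *: ((1%:M + P)^t* *m (1%:M + P)).
    rewrite adjmxD adjmx1 pauli_mx_adj mulmxDl mul1mx mulmxDr mulmx1.
    have -> : P *m P = 1%:M by rewrite -{2}[P]pauli_mx_adj pauli_mx_unitary.
    have half : 2^-1 + 2^-1 = 1 :> C by field.
    by rewrite [P + _]addrC scalerDr -scalerDl half scale1r.
  move=> u; rewrite -scalemxAr -scalemxAl mxE mulr_ge0 ?invr_ge0//.
  exact: psd_gram.
have PE : P = (1%:M + P) - 1%:M by rewrite addrC addKr.
have real_hs (A B : op) : psd A -> psd B -> hs A (chan N B) \is Num.real.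
  move=> Apsd Bpsd; apply: ger0_real; apply: hs_psd_ge0 Apsd _.
  exact: psd_completely_positive cp Bpsd.
have hsBl (A B D : op) : hs (A - B) D = hs A D - hs B D.
  by rewrite /hs !(linearB, map_mxB, mulmxBl) /= -?linearB.
have hsBr (A B D : op) : hs A (B - D) = hs A B - hs A D.
  by rewrite /hs mulmxBr linearB.
have one_psd := @psd1 R (qdim n).
by rewrite PE linearB !(hsBl, hsBr) /= !rpredB ?real_hs.
Qed.

(** The label 0 is the identity, so this is trace preservation. [spectral_gap] excludes this label,
    which is therefore treated apart later. *)
Lemma pauli_eigenvalue0 : pauli_eigenvalue N 0 = 1.
Proof.
have : hs (pauli_vec R (0 : pauli n)) (chan N (pauli_vec R 0)) = 1.
  rewrite /pauli_vec pauli_mx0 chanZ hsZ /hs adjmxZ adjmx1 -scalemxAl mul1mx mxtraceZ.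
  rewrite tp mxtrace1 fmorphV /= (CrealP _); last by rewrite ger0_real// sqrtC_ge0.
  by rewrite mulrA -invfM -expr2 sqrtCK mulVf ?card_qdim_neq0.
by rewrite pauli_vec_eigenvalue => /(congr1 (@complex.Re R)).
Qed.

Lemma run_state_rcons H (s : seq (pauli n)) a :
  run_state N H (rcons s a) = pauli_gate a (chan N (run_state N H s)).
Proof. by rewrite /run_state -cats1 foldl_cat. Qed.

Lemma run_state_density H (s : seq (pauli n)) :
  stabilizer_group H -> density_operator (run_state N H s).
Proof.
case: Ngtm => _ _ HN /HN[rho _ _]; elim/last_ind: s => // s a [IHpsd IHtr].
rewrite run_state_rcons; split; last by rewrite pauli_gate_trace tp.
exact/pauli_gate_psd/psd_completely_positive.
Qed.

(** The first of the m + 1 gates only projects the state [chan N (prep N H)] on the line of [h];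
    each later gate contributes one eigenvalue, which makes the exponent [m]. *)
Lemma run_state_twirl H h m :
  \sum_(s : m.+1.-tuple (pauli n))
      (pauli_sign R h (\sum_(a <- s) a))%:C%C *: run_state N H s =
    ((4 ^ n)%:R ^+ m.+1 * (pauli_eigenvalue N h ^+ m)%:C%C *
      hs (pauli_vec R h) (chan N (prep N H))) *: pauli_vec R h.
Proof.
pose W k := \sum_(s : k.-tuple (pauli n))
      (pauli_sign R h (\sum_(a <- s) a))%:C%C *: run_state N H s.
have WS k : W k.+1 = (4 ^ n)%:R *: (hs (pauli_vec R h) (chan N (W k)) *: pauli_vec R h).
  rewrite -pauli_twirl /W.
  rewrite (big_tuple_rcons k (fun s : seq (pauli n) =>
    (pauli_sign R h (\sum_(a <- s) a))%:C%C *: run_state N H s)).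
  rewrite exchange_big; apply: eq_bigr => a _; rewrite linear_sum.
  under [X in pauli_gate a X]eq_bigr do rewrite chanZ.
  rewrite pauli_gate_sum scaler_sumr; apply: eq_bigr => s _.
  rewrite run_state_rcons scalerA -rmorphM; congr (_%:C%C *: _).
  by rewrite -cats1 big_cat big_seq1 /= pauli_signDr mulrC.
have W0 : W 0%N = prep N H.
  rewrite /W (big_pred1 [tuple]) => [|s]; last by rewrite [s]tuple0 /= eqxx.
  by rewrite big_nil /pauli_sign sympC symp0 expr0 scale1r.
rewrite -/(W m.+1); elim: m => [|m IH].
  by rewrite WS W0 scalerA expr1 expr0 mulr1.
rewrite WS IH chanZ hsZ pauli_vec_eigenvalue [LHS]scalerA; congr (_ *: _).
rewrite [_ ^+ m.+2]exprS [pauli_eigenvalue N h ^+ m.+1]exprS rmorphM.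
have regroup (K : comPzRingType) (k x y c f : K) :
  k * (x * y * c * f) = k * x * (f * y) * c by ring.
exact: regroup.
Qed.

Lemma sum_run_prob H m (phi : syndrome H -> R) :
  \sum_z phi z * run_prob N m z =
  \sum_(s : m.+1.-tuple (pauli n)) ((4 ^ n)%:R^-1) ^+ m.+1 *
    \sum_b phi (syndrome_shift b (\sum_(a <- s) a)) *
       complex.Re (hs (povm N b) (run_state N H s)).
Proof.
rewrite /run_prob card_pauli; under eq_bigr do rewrite mulr_sumr.
rewrite exchange_big; apply: eq_bigr => s _ /=.
under eq_bigr do rewrite mulrCA; rewrite -mulr_sumr; congr (_ * _).
rewrite [RHS](partition_big (fun b => syndrome_shift b (\sum_(a <- s) a)) xpredT) //=.
by apply: eq_bigr => z _; rewrite mulr_sumr; apply: eq_bigr => b /eqP ->.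
Qed.

Lemma run_prob_ge0 H m (z : syndrome H) : stabilizer_group H -> 0 <= run_prob N m z.
Proof.
move=> Hst; case: Ngtm => _ _ /(_ H Hst)[_ Epsd _].
apply: sumr_ge0 => s _; rewrite mulr_ge0 ?exprn_ge0 ?invr_ge0//.
apply: sumr_ge0 => b _; apply/Re_ge0/hs_psd_ge0 => //.
by case: (run_state_density s Hst).
Qed.

Lemma sum_run_prob1 H m : stabilizer_group H -> \sum_(z : syndrome H) run_prob N m z = 1.
Proof.
move=> Hst; case: Ngtm => _ _ /(_ H Hst)[_ _ Esum].
have := sum_run_prob m (fun _ : syndrome H => 1).
under eq_bigr do rewrite mul1r; move=> ->.
rewrite (eq_bigr (fun=> ((4 ^ n)%:R^-1) ^+ m.+1)) => [|s _].
  rewrite sumr_const card_tuple card_pauli -[LHS]mulr_natr.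
  rewrite [X in _ * X]natrX -exprMn mulVf ?expr1n//.
  by rewrite pnatr_eq0 expn_eq0.
under eq_bigr do rewrite mul1r.
rewrite -Re_sum.
have -> : \sum_(b : syndrome H) hs (povm N b) (run_state N H s) =
    \tr ((\sum_(b : syndrome H) povm N b)^t* *m run_state N H s).
  by rewrite linear_sum /= (raddf_sum (map_mx _)) mulmx_suml linear_sum.
have [_ tr1] := run_state_density s Hst.
by rewrite Esum adjmx1 mul1mx tr1 mulr1.
Qed.

Lemma hs_sum (I : finType) M (F : I -> op) : hs M (\sum_i F i) = \sum_i hs M (F i).
Proof. by apply: big_morph; [exact: hsD | rewrite /hs mulmx0 mxtrace0]. Qed.

(** The sign of the reported class is that of the raw outcome times those of the gate labels. The
    latter turn the average over gates into a twirl, so SPAM enters only as a factor independent of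
    [m]. *)
Lemma run_prob_sign H m h : stabilizer_group H -> h \in H ->
  \sum_(z : syndrome H) run_prob N m z * pauli_sign R h (repr (syndrome_set z))
    = spam N H h * pauli_eigenvalue N h ^+ m.
Proof.
move=> Hst hH; under eq_bigr do rewrite mulrC.
rewrite (sum_run_prob m (fun z : syndrome H => pauli_sign R h (repr (syndrome_set z)))).
rewrite -mulr_sumr exchange_big /=.
transitivity (((4 ^ n)%:R^-1) ^+ m.+1 * \sum_(b : syndrome H)
    pauli_sign R h (repr (syndrome_set b)) * complex.Re (hs (povm N b)
      (\sum_(s : m.+1.-tuple (pauli n))
        (pauli_sign R h (\sum_(a <- s) a))%:C%C *: run_state N H s))).
  congr (_ * _); apply: eq_bigr => b _.
  rewrite hs_sum Re_sum mulr_sumr; apply: eq_bigr => s _.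
  by rewrite -/(syndrome_shift b _) pauli_sign_shift// hsZ Re_realM mulrA.
rewrite /spam Re_sum mulr_sumr mulr_suml; apply: eq_bigr => b _.
rewrite run_state_twirl hsZ -[in RHS](mulrA (pauli_sign _ _ _)%:C%C) Re_realM.
set c := hs _ (chan _ _); set e := hs _ (pauli_vec R h).
have -> : (4 ^ n)%:R ^+ m.+1 * (pauli_eigenvalue N h ^+ m)%:C%C * c * e =
  ((4 ^ n)%:R ^+ m.+1 * pauli_eigenvalue N h ^+ m)%:C%C * (e * c).
  rewrite [in RHS]rmorphM [X in _ = X * _ * _]rmorphXn.
  by rewrite rmorph_nat; ring.
have K1 : ((4 ^ n)%:R^-1) ^+ m.+1 * (4 ^ n)%:R ^+ m.+1 = 1 :> R.
  by rewrite -exprMn mulVf ?expr1n// pnatr_eq0 expn_eq0.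
by rewrite Re_realM -[RHS]mul1r -[X in _ = X * _]K1; ring.
Qed.

End Runs.

(** * Stability of exponential decay *)

Section Analysis.
Variable R : realType.
Implicit Types (x A f e D : R).

(** From exp(-x) >= 1 - x and (1 + x + 2 x^2)(1 - x) = 1 + x^2 (1 - 2 x). *)
Lemma expR_le_quadratic x : x <= 2^-1 -> expR x <= 1 + x + 2 * x ^+ 2.
Proof.
move=> x_le.
have e1 : 1 - x <= expR (- x) by exact: expR_ge1Dx.
have ex_gt0 := expR_gt0 x.
have : expR x * (1 - x) <= 1.
  by rewrite -[leRHS](expRxMexpNx_1 x) ler_pM2l.
move=> h; rewrite -(@ler_pM2r _ (1 - x)); last by lra.
apply: le_trans h _; have : 0 <= x ^+ 2 * (1 - 2 * x).
  by apply: mulr_ge0; [exact: sqr_ge0 | lra].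
by nra.
Qed.

(** The sum is the cofactor of x - y in x^m - y^m. Its exponents are below [m] and the bases at most
    1, so each factor is at least [c]. *)
Lemma sumr_expM_ge (x y c : R) m : 0 <= c -> c <= x ^+ m -> c <= y ^+ m ->
  0 <= x <= 1 -> 0 <= y <= 1 ->
  m%:R * c ^+ 2 <= \sum_(i < m) x ^+ (m.-1 - i) * y ^+ i.
Proof.
move=> c0 cx cy /andP[x0 x1] /andP[y0 y1].
rewrite mulr_natl -[m in leLHS]card_ord -sumr_const.
apply: ler_sum => i _; rewrite expr2; apply: ler_pM => //.
  apply: le_trans cx _; apply: ler_wiXn2l => //.
  by apply: leq_trans (leq_subr _ _) (leq_pred _).
by apply: le_trans cy _; apply: ler_wiXn2l => //; rewrite ltnW.
Qed.

(** f^m <= exp(-D m) <= 1 / (1 + D m). *)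
Lemma expr_le_half D f m : 0 <= f <= 1 - D -> 1 <= D * m%:R -> f ^+ m <= 2^-1.
Proof.
move=> /andP[f0 fD] Dm.
have f_le : f <= expR (- D) by apply: le_trans fD _; exact: expR_ge1Dx.
have : f ^+ m <= expR (- D) ^+ m by apply: lerXn2r; rewrite ?nnegrE// expR_ge0.
move/le_trans; apply; rewrite -expRM_natr.
have := expR_ge1Dx (D * m%:R) => h.
rewrite mulNr expRN; rewrite lef_pV2 ?posrE ?expR_gt0//.
by lra.
Qed.

(** At the first doubling where the power drops to 1/2 or below, it is the square of a number above
    1/2. At length 1 the lower bound comes from f >= 1/2. *)
Lemma exists_decay_length f J : 2^-1 <= f -> f ^+ (2 ^ J) <= 2^-1 ->
  exists2 j, (j <= J)%N & 4^-1 <= f ^+ (2 ^ j) <= 2^-1.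
Proof.
move=> f_ge; elim: J => [|J IH] fJ.
  by exists 0%N => //; rewrite fJ andbT expn0 expr1; lra.
have [fJ'|/ltW fJ'] := leP (f ^+ (2 ^ J)) 2^-1.
  by have [j jJ fj] := IH fJ'; exists j => //; exact: leqW.
exists J.+1 => //; rewrite fJ andbT expnSr exprM.
have -> : (4^-1 : R) = 2^-1 ^+ 2 by field.
by apply: lerXn2r; rewrite ?nnegrE //; lra.
Qed.

(** At the length m where f^m lies in [1/4, 1/2], an error 16 e on f^m is divided by a cofactor of
    at least m / 64, and m (1 - f) >= 1/2 turns 1 / m into 1 - f: 2048 = 16 * 64 * 2. *)
Lemma decay_rate_stable A A' f f' e D J :
  0 <= e <= 128^-1 -> 2^-1 <= A ->
  2^-1 <= f <= 1 -> 2^-1 <= f' <= 1 -> f <= 1 - D -> 1 <= D * (2 ^ J)%:R ->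
  `|A - A'| <= 4 * e ->
  (forall j, (j <= J)%N -> `|A * f ^+ (2 ^ j) - A' * f' ^+ (2 ^ j)| <= 4 * e) ->
  `|f - f'| <= 2048 * e * (1 - f).
Proof.
move=> /andP[e0 e_le] A_ge f01 f'01 fD DJ AA' Aff'.
have [f_ge f_le] := andP f01; have [f'_ge f'_le] := andP f'01.
have [|j jJ /andP[fj_ge fj_le]] := @exists_decay_length f J f_ge.
  by apply: (@expr_le_half D) => //; apply/andP; split=> //; lra.
set m := (2 ^ j)%N in fj_ge fj_le.
have m_gt0 : (0 : R) < m%:R by rewrite ltr0n expn_gt0.
have {}Aff' := Aff' _ jJ.
have f'm0 : 0 <= f' ^+ m by apply: exprn_ge0; lra.
have f'm1 : f' ^+ m <= 1 by apply: exprn_ile1; lra.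
(* The error at length 0 controls A - A'; together with the error at length [m] it gives 8 e, which
   A >= 1/2 doubles. *)
have dfm : `|f ^+ m - f' ^+ m| <= 16 * e.
  have : A * `|f ^+ m - f' ^+ m| <= 8 * e.
    rewrite -[A in A * _]ger0_norm; last by lra.
    rewrite -normrM.
    have -> : A * (f ^+ m - f' ^+ m) =
      (A * f ^+ m - A' * f' ^+ m) + (A' - A) * f' ^+ m by ring.
    apply: le_trans (ler_normD _ _) _.
    have -> : 8 * e = 4 * e + 4 * e by ring.
    apply: lerD => //; rewrite normrM (ger0_norm f'm0) distrC.
    by rewrite -[leRHS]mulr1; apply: ler_pM.
  move=> h.
  have : 2^-1 * `|f ^+ m - f' ^+ m| <= A * `|f ^+ m - f' ^+ m|.
    by apply: ler_wpM2r.
  by lra.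
(* This is where e <= 1/128 is used: 1/4 - 16 e >= 1/8. *)
have f'm_ge : 8^-1 <= f' ^+ m.
  have : f ^+ m - f' ^+ m <= 16 * e by apply: le_trans dfm; exact: ler_norm.
  by lra.
have sum_ge : m%:R * 8^-1 ^+ 2 <= \sum_(i < m) f ^+ (m.-1 - i) * f' ^+ i.
  by apply: sumr_expM_ge => //; try (apply/andP; split); lra.
have r_ge : 2^-1 <= m%:R * (1 - f).
  have : 1 - f ^+ m <= m%:R * (1 - f).
    rewrite -[1 - f ^+ m]opprB subrX1 -mulNr opprB mulrC.
    apply: ler_wpM2r; first lra.
    rewrite -[m in leRHS]card_ord -sumr_const; apply: ler_sum => i _.
    by apply: exprn_ile1; lra.
  by lra.
have : `|f - f'| * (m%:R * 8^-1 ^+ 2) <= 16 * e.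
  apply: le_trans dfm; rewrite subrXX normrM; apply: ler_wpM2l => //.
  by apply: le_trans (ler_norm _).
move=> h; rewrite -(@ler_pM2r _ (m%:R * 8^-1 ^+ 2)); last first.
  by rewrite mulr_gt0// exprn_gt0// invr_gt0 ltr0n.
apply: le_trans h _.
by have := ler_wpM2l e0 r_ge; lra.
Qed.
End Analysis.

(** * Concentration *)

(** Outcome types vary with the round, so data are dependent functions. Tagging embeds every [T i]
    in one sum type, where the usual distributivity applies. *)
Lemma bigA_distr_dffun (R : comPzRingType) (I : finType) (T : I -> finType)
    (F : forall i, T i -> R) :
  \sum_(D : {dffun forall i, T i}) \prod_i F i (D i) = \prod_i \sum_z F i z.
Proof.
pose P i : {ffun T i -> R} := [ffun z => F i z].
transitivity (\prod_i \sum_(j in tagged_with T i) untag 0 (P i) j).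
  rewrite bigA_distr_big_dep -(@big_fprod R 0 1 *%R +%R) /=.
  rewrite (reindex (@dffun_of_fprod I T)); last first.
    exact/onW_bij/dffun_of_fprod_bij.
  apply: eq_bigr => D _; apply: eq_bigr => i _.
  by rewrite !ffunE.
apply: eq_bigr => i _; rewrite -(big_tag (fun i z => P i z)).
by apply: eq_bigr => z _; rewrite ffunE.
Qed.

Section Concentration.
Variable R : realType.

(* Bernstein's moment method for a sign-valued variable, with
   exp x <= 1 + x + 2 x ^ 2 in place of Hoeffding's lemma. *)
Lemma sign_mgf_le (T : finType) (w X : T -> R) (l mu : R) :
  (forall z, 0 <= w z) -> \sum_z w z = 1 -> (forall z, X z ^+ 2 = 1) ->
  \sum_z w z * X z = mu -> `|l| <= 4^-1 ->
  \sum_z w z * expR (l * (X z - mu)) <= expR (2 * l ^+ 2).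
Proof.
move=> w0 w1 X2 wX l_le.
have Xle z : `|X z| <= 1.
  by rewrite -(@expr_le1 _ 2) // -normrX X2 normr1.
have mu_le : `|mu| <= 1.
  rewrite -wX; apply: le_trans (ler_norm_sum _ _ _) _.
  rewrite -w1; apply: ler_sum => z _; rewrite normrM (ger0_norm (w0 z)).
  by rewrite -[leRHS]mulr1; apply: ler_wpM2l.
apply: le_trans (expR_ge1Dx _).
apply: (@le_trans _ _
    (\sum_z w z * (1 + l * (X z - mu) + 2 * (l * (X z - mu)) ^+ 2))).
  apply: ler_sum => z _; apply: ler_wpM2l => //; apply: expR_le_quadratic.
  apply: le_trans (ler_norm _) _; rewrite normrM.
  have -> : (2^-1 : R) = 4^-1 * 2 by field.
  apply: ler_pM => //; apply: le_trans (ler_normB _ _) _.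
  by rewrite [leRHS](_ : 2 = 1 + 1)//; apply: lerD.
(* X^2 = 1 makes the quadratic affine in X; its mean is 1 + 2 l^2 (1 - mu^2). *)
have -> : \sum_z w z * (1 + l * (X z - mu) + 2 * (l * (X z - mu)) ^+ 2) =
  \sum_z (w z * (1 - l * mu + 2 * l ^+ 2 * (1 + mu ^+ 2))
          + (w z * X z) * (l - 4 * l ^+ 2 * mu)).
  apply: eq_bigr => z _.
  rewrite -[RHS]addr0 -(mulr0 (2 * l ^+ 2 * w z)).
  have -> : 0 = X z ^+ 2 - 1 by rewrite X2 subrr.
  by ring.
rewrite big_split /= -!mulr_suml w1 wX.
have := sqr_ge0 (l * mu); nra.
Qed.

Section Product.
Variables (I : finType) (T : I -> finType) (w : forall i, T i -> R).
Hypotheses (w_ge0 : forall i (z : T i), 0 <= w z)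
  (w_sum1 : forall i, \sum_(z : T i) w z = 1).
Variables (A : {set I}) (eps : R).
Hypothesis eps_le : 0 <= eps <= 2^-1.

(** Markov's inequality for the exponential of [l] times the sum, whose moment factorises over the
    coordinates. *)
Lemma sign_upper_tail (mu : R) (X : forall i, T i -> R) :
  (forall i z, X i z ^+ 2 = 1) -> {in A, forall i, \sum_z w z * X i z = mu} ->
  \sum_(D : {dffun forall i, T i} |
      2 * eps * #|A|%:R < \sum_(i in A) (X i (D i) - mu)) \prod_i w (D i)
    <= expR (- (eps ^+ 2 / 2 * #|A|%:R)).
Proof.
(* l = eps / 2 minimises the exponent 2 l^2 - 2 eps l, and eps <= 1/2 keeps it within the range of
   [sign_mgf_le]. *)
move=> X2 wX; have /andP[eps0 eps1] := eps_le; pose l := eps / 2.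
pose F i (z : T i) := w z * (if i \in A then expR (l * (X i z - mu)) else 1).
have F_ge0 i (z : T i) : 0 <= F i z.
  by apply: mulr_ge0 => //; case: ifP => // _; exact: expR_ge0.
have FE (D : {dffun forall i, T i}) : \prod_i F i (D i) =
    (\prod_i w (D i)) * expR (l * \sum_(i in A) (X i (D i) - mu)).
  rewrite big_split /=; congr (_ * _).
  by rewrite -big_mkcond mulr_sumr expR_sum.
apply: (@le_trans _ _ (expR (- (eps ^+ 2 * #|A|%:R)) *
    \sum_(D : {dffun forall i, T i}) \prod_i F i (D i))).
  rewrite mulr_sumr big_mkcond; apply: ler_sum => D _.
  case: ifP => [hD|_]; last by rewrite mulr_ge0 ?expR_ge0 ?prodr_ge0.
  rewrite FE mulrCA -expRD -[leLHS]mulr1; apply: ler_wpM2l.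
    exact: prodr_ge0.
  apply: le_trans (expR_ge1Dx _); rewrite lerDl.
  have : l * (2 * eps * #|A|%:R) <= l * \sum_(i in A) (X i (D i) - mu).
    by apply: ler_wpM2l (ltW hD); rewrite /l; lra.
  by rewrite /l; lra.
rewrite bigA_distr_dffun (bigID (mem A)) /= [X in _ * (_ * X)]big1 ?mulr1; last first.
  move=> i /negPf iA; rewrite -[RHS](w_sum1 i); apply: eq_bigr => z _.
  by rewrite /F iA mulr1.
apply: (@le_trans _ _ (expR (- (eps ^+ 2 * #|A|%:R)) *
    \prod_(i in A) expR (2 * l ^+ 2))).
  apply: ler_wpM2l; first exact: expR_ge0.
  apply: ler_prod => i iA; apply/andP; split; first by apply: sumr_ge0.
  apply: le_trans (sign_mgf_le (@w_ge0 i) (w_sum1 i) (X2 i) (wX i iA) _).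
    by apply: ler_sum => z _; rewrite /F iA.
  by rewrite /l ger0_norm; lra.
rewrite prodr_const -expRM_natr -expRD ler_expR /l.
by rewrite le_eqVlt; apply/orP; left; apply/eqP; field.
Qed.

Lemma sign_mean_tail (mu : R) (X : forall i, T i -> R) :
  (forall i z, X i z ^+ 2 = 1) -> {in A, forall i, \sum_z w z * X i z = mu} ->
  \sum_(D : {dffun forall i, T i} |
      2 * eps * #|A|%:R < `|\sum_(i in A) (X i (D i) - mu)|) \prod_i w (D i)
    <= 2 * expR (- (eps ^+ 2 / 2 * #|A|%:R)).
Proof.
move=> X2 wX.
have X2N i z : (- X i z) ^+ 2 = 1 by rewrite sqrrN.
have wXN : {in A, forall i, \sum_z w z * - X i z = - mu}.
  by move=> i iA; under eq_bigr do rewrite mulrN; rewrite sumrN wX.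
have := lerD (sign_upper_tail X2 wX) (sign_upper_tail X2N wXN).
rewrite -mulr2n -[leRHS]mulr_natl; apply: le_trans.
rewrite [in leRHS]big_mkcond [X in _ <= _ + X]big_mkcond -big_split /=.
rewrite big_mkcond; apply: ler_sum => D _.
have -> : \sum_(i in A) (- X i (D i) - - mu) = - \sum_(i in A) (X i (D i) - mu).
  by rewrite -sumrN; apply: eq_bigr => i _; rewrite opprB opprK addrC.
have p0 : 0 <= \prod_i w (D i) by exact: prodr_ge0.
by rewrite lter_normr; case: (_ < _); case: (_ < _) => /=;
  rewrite ?addr0 ?add0r ?lerDl.
Qed.
End Product.
End Concentration.

(** * Estimation *)

(** [J] is least with Delta 2^J >= 1. Since Delta <= 1/2, it is positive and its predecessor bounds
    2^J. The third bound counts the lengths 0, 1, 2, ..., 2^J. *)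
Lemma exists_doubling_length (R : realType) (Delta : R) : 0 < Delta <= 2^-1 ->
  exists J, [/\ 1 <= Delta * (2 ^ J)%:R, (2 ^ J)%:R <= 2 / Delta &
    J.+2%:R <= 4 / ln 2 * ln (1 / Delta)].
Proof.
move=> /andP[D0 D1].
have /ex_minnP[J J1 minJ] : exists J, 1 <= Delta * (2 ^ J)%:R.
  exists (Num.bound Delta^-1).
  rewrite -[leLHS](mulfV (lt0r_neq0 D0)) ler_pM2l//.
  apply: le_trans (ltW (archi_boundP _)) _; first by rewrite invr_ge0 ltW.
  by rewrite ler_nat ltnW// ltn_expl.
case: J J1 minJ => [|J] J1 minJ.
  by move: J1; rewrite expn0 mulr1 => J1; lra.
have DJ : Delta * (2 ^ J)%:R < 1.
  by rewrite ltNge; apply/negP => /minJ; rewrite ltnn.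
have ln2 : 0 < ln 2 :> R by rewrite ln_gt0// ltr1n.
exists J.+1; split=> //.
  rewrite ler_pdivlMr// expnS natrM mulrC mulrCA -[leRHS]mulr1.
  by apply: ler_wpM2l => //; exact: ltW.
have h1 : J%:R * ln 2 <= ln (1 / Delta).
  rewrite mulr_natl -lnXn// ler_ln ?posrE ?exprn_gt0 ?divr_gt0//.
  by rewrite ler_pdivlMr// mulrC -natrX ltW.
have h2 : ln 2 <= ln (1 / Delta).
  by rewrite ler_ln ?posrE ?divr_gt0// ler_pdivlMr//; lra.
(* For the witness J + 1 the count is J + 3: one logarithm covers J ln 2 and three cover 3 ln 2,
   whence the constant 4. *)
rewrite mulrAC ler_pdivlMr// -addn3 natrD mulrDl.
have h3 : 3%:R * ln 2 <= 3%:R * ln (1 / Delta) by apply: ler_wpM2l.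
by move: (ln (1 / Delta)) h1 h2 h3 => L h1 h2 h3; lra.
Qed.

Lemma union_bound (R : realType) (T I : finType) (P : T -> R) (B : {set I})
    (bad : I -> pred T) (c : R) :
  (forall D, 0 <= P D) -> \sum_D P D = 1 ->
  (forall i, i \in B -> \sum_(D | bad i D) P D <= c) ->
  1 - c * #|B|%:R <= \sum_(D | [forall i in B, ~~ bad i D]) P D.
Proof.
move=> P0 P1 Pbad; rewrite lerBlDr -[leLHS]P1.
apply: (@le_trans _ _ (\sum_(D | [forall i in B, ~~ bad i D]) P D +
    \sum_(i in B) \sum_(D | bad i D) P D)); last first.
  by rewrite lerD2l mulr_natr -sumr_const; apply: ler_sum.
have -> : \sum_(i in B) \sum_(D | bad i D) P D =
    \sum_D \sum_(i in B) (if bad i D then P D else 0).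
  by rewrite exchange_big; apply: eq_bigr => i _; rewrite big_mkcond.
rewrite [X in _ <= X + _]big_mkcond -big_split /=; apply: ler_sum => D _.
have sum0 (A : {pred I}) : 0 <= \sum_(i in B | A i) (if bad i D then P D else 0).
  by apply: sumr_ge0 => i _; case: ifP.
case: ifPn => [_|]; first by rewrite lerDl; apply: sumr_ge0 => i _; case: ifP.
rewrite negb_forall_in => /exists_inP[i iB]; rewrite negbK => bi.
rewrite add0r (bigD1 i) //= bi lerDl; exact: sum0.
Qed.

(** The estimate is [theta] of a model chosen among those compatible with the data, so it depends on
    the data alone; [v0] is returned when no model fits. *)
Lemma exists_consistent_estimator (M D V : Type) (compatible : M -> D -> Prop)
    (theta : M -> V) (close : V -> M -> Prop) (v0 : V) :
  (forall N N' d, compatible N d -> compatible N' d -> close (theta N') N) ->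
  exists est : D -> V, forall N d, compatible N d -> close (est d) N.
Proof.
move=> closeP.
exists (fun d => if pselect (exists N, compatible N d) is left e
                 then theta (projT1 (cid e)) else v0) => N d Nd.
case: pselect => [e|[]]; last by exists N.
exact: closeP Nd (projT2 (cid e)).
Qed.

(** * From eigenvalues to marginal rates, and the number of shots *)

Section Estimation.
Variables (R : realType) (n : nat).
Implicit Types (G H : {group pauli n}) (N : noise R n).

Lemma infidelity_le_norm N G g : g \in G ->
  `|infidelity N g| <= infidelity_norm N G.
Proof. by move=> gG; apply: (le_bigmax_cond _ (fun g => `|infidelity N g|)). Qed.

(** By Parseval the Euclidean error is the root mean square over [G] of the eigenvalue errors, so a
    uniform bound passes through without a dimension factor. *)
Lemma marginal_rate_error N N' G (c : R) : 0 <= c ->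
  {in G, forall g, `|pauli_eigenvalue N g - pauli_eigenvalue N' g|
                     <= c * infidelity_norm N G} ->
  l2norm (fun a : syndrome G => marginal_rate N' a - marginal_rate N a)
    <= c * infidelity_norm N G.
Proof.
move=> c0 Hc.
have norm0 : 0 <= infidelity_norm N G.
  by apply: le_trans (infidelity_le_norm N (pauli_group0 G)).
rewrite -[leRHS]ger0_norm ?mulr_ge0// -sqrtr_sqr; apply: ler_wsqrtr.
pose u g := pauli_eigenvalue N' g - pauli_eigenvalue N g.
have -> : \sum_(a : syndrome G) (marginal_rate N' a - marginal_rate N a) ^+ 2 =
    \sum_(a : syndrome G) (\sum_(c in syndrome_set a)
      (4 ^+ n)^-1 * \sum_b pauli_sign R c b * u b) ^+ 2.
  apply: eq_bigr => a _; congr (_ ^+ 2); rewrite -sumrB; apply: eq_bigr => b _.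
  rewrite -mulrBr -sumrB; congr (_ * _); apply: eq_bigr => g _.
  by rewrite -mulrBr.
rewrite syndrome_parseval ler_pdivrMl ?ltr0n ?cardG_gt0//.
rewrite mulr_natl -sumr_const; apply: ler_sum => g gG.
rewrite -real_normK ?num_real//; apply: lerXn2r; rewrite ?nnegrE ?mulr_ge0//.
by rewrite distrC Hc.
Qed.

Lemma sum_data_prob N r t (H : 'I_r -> {group pauli n}) (m : 'I_r -> nat) :
  gtm N -> (forall i, stabilizer_group (H i)) ->
  \sum_(D : data t H) data_prob N m D = 1.
Proof.
move=> Ngtm Hst.
rewrite /data_prob (bigA_distr_dffun (fun (x : 'I_r * 'I_t) z => run_prob N (m x.1) z)).
by apply: big1 => x _; apply: sum_run_prob1.
Qed.

Lemma data_prob_ge0 N r t (H : 'I_r -> {group pauli n}) (m : 'I_r -> nat)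
    (D : data t H) :
  gtm N -> (forall i, stabilizer_group (H i)) -> 0 <= data_prob N m D.
Proof. by move=> Ngtm Hst; apply: prodr_ge0 => x _; apply: run_prob_ge0. Qed.

Lemma prob_le N r t (H : 'I_r -> {group pauli n}) (m : 'I_r -> nat)
    (E F : pred (data t H)) :
  gtm N -> (forall i, stabilizer_group (H i)) -> (forall D, E D -> F D) ->
  prob N m E <= prob N m F.
Proof.
move=> Ngtm Hst EF; rewrite /prob big_mkcond [leRHS]big_mkcond.
apply: ler_sum => D _; case: ifP => [/EF ->//|_].
by case: ifP => // _; apply: data_prob_ge0.
Qed.

Lemma pauli_eigenvalue_le_gap N G g (Delta : R) :
  g \in G -> g != 0 -> Delta <= spectral_gap N G ->
  pauli_eigenvalue N g <= 1 - Delta.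
Proof.
move=> gG g0; rewrite /spectral_gap.
have : `|pauli_eigenvalue N g| <=
    \big[Order.max/0]_(g in G | g != 0) `|pauli_eigenvalue N g|.
  by apply: (le_bigmax_cond _ (fun g => `|pauli_eigenvalue N g|)); rewrite gG.
have := ler_norm (pauli_eigenvalue N g); lra.
Qed.

Lemma card_quotient_stabilizer G S k : maximal_stabilizer_subgroup S G ->
  #|G| = (4 ^ k * #|G :&: commutant G|)%N ->
  Num.sqrt #|(G / S)%g|%:R = 2 ^+ k :> R.
Proof.
move=> /maximal_stabilizerE SE; rewrite -SE => cardG.
have SG : S \subset G by rewrite SE subsetIl.
rewrite card_quotient; last first.
  by apply: normal_norm; rewrite -(sub_abelian_normal _ (pauli_abelian G)).
rewrite -divgS// cardG mulnK ?cardG_gt0// natrX (_ : 4%:R = 2 ^+ 2).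
  by rewrite -exprM mulnC exprM sqrtr_sqr ger0_norm ?exprn_ge0.
by rewrite -natrX.
Qed.

(** The shot count is the inversion of the tail bound at failure probability delta / (k c). As delta
    < 1, the logarithm is positive and at least one shot is made. *)
Lemma shots_tail (eps delta : R) (k c : nat) : 0 < eps -> 0 < delta < 1 ->
  (0 < k)%N -> (0 < c)%N ->
  (0 < shots eps delta k c)%N /\
  2 * expR (- (eps ^+ 2 / 2 * (shots eps delta k c)%:R)) <= delta / (k * c)%:R.
Proof.
move=> eps0 /andP[delta0 delta1] k0 c0.
set t := shots eps delta k c.
have kc0 : (1 : R) <= (k * c)%:R by rewrite ler1n muln_gt0 k0.
pose x := 2 * k%:R * c%:R / delta.
have xE : x = 2 * (k * c)%:R / delta by rewrite /x natrM mulrA.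
have x1 : 1 < x.
  rewrite xE ltr_pdivlMr// mul1r; lra.
have t_ge : 2 / eps ^+ 2 * ln x <= t%:R.
  rewrite natr_absz; apply: le_trans (ceil_ge _) _.
  by rewrite intr_norm ler_norm.
have e2 : 0 < eps ^+ 2 by rewrite exprn_gt0.
have lnx : 0 < ln x by rewrite ln_gt0.
split.
  rewrite -(ltr_nat R); apply: lt_le_trans t_ge.
  by rewrite mulr_gt0 ?divr_gt0.
have : ln x <= eps ^+ 2 / 2 * t%:R.
  rewrite mulrAC ler_pdivlMr//.
  move: t_ge; rewrite mulrAC ler_pdivrMr//; lra.
rewrite -lerN2 -(ler_expR (- _)) => /le_trans h.
have : expR (- (eps ^+ 2 / 2 * t%:R)) <= x^-1.
  by apply: h; rewrite expRN lnK// posrE (lt_trans ltr01).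
rewrite xE invf_div => h2.
have -> : delta / (k * c)%:R = 2 * (delta / (2 * (k * c)%:R)).
  by field; rewrite !pnatr_eq0 -!lt0n c0 k0.
by apply: ler_wpM2l.
Qed.

End Estimation.

(* Round [i] of a schedule with [b] stabilizer groups uses group [i %% b] and
   the length with index [i %/ b]: the lengths are 0, 1, 2, 4, ... *)
Section Schedule.
Variables (J b : nat).
Local Notation r := (J.+2 * b.+1)%N.

Definition run_length (q : nat) : nat := if q is q'.+1 then 2 ^ q' else 0.

Definition round_length (i : 'I_r) : nat := run_length (i %/ b.+1).

Definition round_group (i : 'I_r) : 'I_b.+1 := inord (i %% b.+1).

Lemma round_index_proof (q : 'I_J.+2) (c : 'I_b.+1) : (q * b.+1 + c < r)%N.
Proof.
apply: leq_trans (_ : q.+1 * b.+1 <= _)%N; last by rewrite leq_mul2r ltn_ord orbT.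
by rewrite mulSn addnC ltn_add2r.
Qed.

Definition round_index q c : 'I_r := Ordinal (round_index_proof q c).

Lemma round_length_index q c : round_length (round_index q c) = run_length q.
Proof. by rewrite /round_length /= divnMDl// divn_small// addn0. Qed.

Lemma round_group_index q c : round_group (round_index q c) = c.
Proof. by rewrite /round_group /= modnMDl modn_small// inord_val. Qed.

Lemma run_length_inj : injective run_length.
Proof.
move=> [|p] [|q] //= => [/eqP|/eqP|/eqP]; rewrite ?[0%N == _]eq_sym ?expn_eq0//.
by rewrite eqn_exp2l// => /eqP ->.
Qed.

Lemma size_round_lengths : size (undup (codom round_length)) = J.+2.
Proof.
rewrite -[RHS](size_iota 0) -(size_map run_length); apply/perm_size/uniq_perm.
- exact: undup_uniq.
- by rewrite map_inj_uniq ?iota_uniq//; exact: run_length_inj.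
move=> x; rewrite mem_undup; apply/codomP/mapP => [[i ->]|[q]].
  by exists (i %/ b.+1)%N => //; rewrite mem_iota add0n ltn_divLR//; exact: ltn_ord.
rewrite mem_iota add0n /= => qJ ->.
by exists (round_index (Ordinal qJ) ord0); rewrite round_length_index.
Qed.

Lemma round_length_le (i : 'I_r) : (round_length i <= 2 ^ J)%N.
Proof.
have : (i %/ b.+1 < J.+2)%N by rewrite ltn_divLR.
rewrite /round_length; case: (i %/ b.+1)%N => [//|q] qJ.
by rewrite /= leq_exp2l.
Qed.

End Schedule.

(** * Simultaneous accuracy of the empirical signs *)

Section RoundStatistics.
Variables (R : realType) (n : nat) (G : {group pauli n}).
Variables (J b : nat) (H : 'I_b.+1 -> {group pauli n}).
Hypotheses (Hst : forall i, stabilizer_group (H i))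
  (Hcover : {in G, forall g, exists i, g \in H i}).
Variables (t : nat) (eps : R).
Local Notation r := (J.+2 * b.+1)%N.
Local Notation Hr := (fun i : 'I_r => H (round_group i)).
Local Notation mr := (@round_length J b).
Implicit Types (g : pauli n) (q : 'I_J.+2) (N : noise R n).

(** A label may lie in several groups of the cover, so one is fixed. The default is never reached on
    [G]. *)
Definition cover_index g : 'I_b.+1 := odflt ord0 [pick i | g \in H i].

Lemma mem_cover_index g : g \in G -> g \in H (cover_index g).
Proof.
move=> /Hcover[i gi]; rewrite /cover_index; case: pickP => [j //|].
by move=> /(_ i); rewrite gi.
Qed.

Definition round_mean N g q : R :=
  spam N (H (cover_index g)) g * pauli_eigenvalue N g ^+ run_length q.

Definition shot_sign g (x : 'I_r * 'I_t) (z : syndrome (Hr x.1)) : R :=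
  pauli_sign R g (repr (syndrome_set z)).

Definition round_shots g q : {set 'I_r * 'I_t} :=
  [set x | x.1 == round_index q (cover_index g)].

Definition deviation N (D : data t Hr) g q : R :=
  \sum_(x in round_shots g q) (shot_sign g (D x) - round_mean N g q).

Definition typical N : pred (data t Hr) := fun D =>
  [forall p in setX G [set: 'I_J.+2],
     ~~ (2 * eps * t%:R < `|deviation N D p.1 p.2|)].

Lemma card_round_shots g q : #|round_shots g q| = t.
Proof.
pose f (s : 'I_t) := (round_index q (cover_index g), s).
have f_inj : injective f by move=> s s' [].
rewrite -[RHS]card_ord -[RHS]cardsT -[RHS](card_imset _ f_inj).
apply: eq_card => -[i s]; rewrite inE; apply/eqP/imsetP => [/= ->|[s' _ [-> _]]//].
by exists s; rewrite ?inE.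
Qed.

(** The failure probability is shared equally among the (J + 2) |G| pairs of a label and a length,
    each controlled by [sign_mean_tail]. *)
Lemma prob_typical N delta : gtm N -> 0 <= eps <= 2^-1 ->
  2 * expR (- (eps ^+ 2 / 2 * t%:R)) <= delta / (J.+2 * #|G|)%:R ->
  1 - delta <= prob N mr (typical N).
Proof.
move=> Ngtm eps01 tail.
have -> : delta = delta / (J.+2 * #|G|)%:R * #|setX G [set: 'I_J.+2]|%:R.
  rewrite cardsX cardsT card_ord mulnC divfK// pnatr_eq0 -lt0n muln_gt0.
  by rewrite cardG_gt0.
apply: union_bound => [D||[g q] /setXP[gG _]].
- exact: data_prob_ge0.
- exact: sum_data_prob.
apply: le_trans tail.
have := (@sign_mean_tail R _ (fun x : 'I_r * 'I_t => syndrome (Hr x.1))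
  (fun x z => run_prob N (mr x.1) z) _ _ (round_shots g q) eps _
  (round_mean N g q) (shot_sign g)).
rewrite card_round_shots; apply => //.
- by move=> x z; apply: run_prob_ge0.
- by move=> x; apply: sum_run_prob1.
- by move=> x z; exact: pauli_sign2.
move=> [i s]; rewrite inE /= => /eqP -> /=.
rewrite /shot_sign /= run_prob_sign ?round_group_index ?mem_cover_index//.
by rewrite round_length_index.
Qed.

(** Both deviations use the same data, so the empirical sums cancel in their difference and only [t]
    times the difference of means is left. *)
Lemma typical_means N N' (D : data t Hr) g q : (0 < t)%N -> g \in G ->
  typical N D -> typical N' D ->
  `|round_mean N g q - round_mean N' g q| <= 4 * eps.
Proof.
move=> t0 gG /forall_inP/(_ (g, q)) HN /forall_inP/(_ (g, q)) HN'.
have gq : (g, q) \in setX G [set: 'I_J.+2] by rewrite !inE gG.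
have {HN} := HN gq; have {HN'} := HN' gq; rewrite /= -!leNgt => h' h.
have tR : 0 < t%:R :> R by rewrite ltr0n.
have : `|deviation N' D g q - deviation N D g q| <= 4 * eps * t%:R.
  apply: le_trans (ler_normB _ _) _; apply: le_trans (lerD h' h) _; lra.
have -> : deviation N' D g q - deviation N D g q =
    (round_mean N g q - round_mean N' g q) * t%:R.
  rewrite /deviation -sumrB (eq_bigr (fun=> round_mean N g q - round_mean N' g q)).
    by rewrite sumr_const card_round_shots mulr_natr.
  by move=> x _; rewrite opprB addrC addrA subrK.
by rewrite normrM (ger0_norm (ltW tR)) ler_pM2r.
Qed.

Lemma typical_eigenvalues N N' (D : data t Hr) g Delta : (0 < t)%N ->
  0 < eps <= 128^-1 -> 1 <= Delta * (2 ^ J)%:R ->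
  gtm N -> half_weak N -> half_stable N -> Delta <= spectral_gap N G ->
  gtm N' -> half_weak N' ->
  g \in G -> typical N D -> typical N' D ->
  `|pauli_eigenvalue N g - pauli_eigenvalue N' g| <= 2048 * eps * infidelity_norm N G.
Proof.
move=> t0 /andP[e0 e1] DJ Ngtm Nw Ns Ngap N'gtm N'w gG Nt N't.
have /andP[f_ge f_le] := Nw g.
apply: (@le_trans _ _ (2048 * eps * (1 - pauli_eigenvalue N g))); last first.
  rewrite ler_wpM2l//; first by rewrite mulr_ge0// ltW.
  apply: le_trans (ler_norm _) _; exact: infidelity_le_norm.
have [->|g0] := eqVneq g 0; first by rewrite !pauli_eigenvalue0// !subrr normr0 mulr0.
apply: (@decay_rate_stable _ (spam N (H (cover_index g)) g)
   (spam N' (H (cover_index g)) g) _ _ _ Delta J) => //.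
- by rewrite ltW.
- by apply: Ns => //; exact: mem_cover_index.
- exact: pauli_eigenvalue_le_gap Ngap.
(* Index 0 is the length 0, which isolates the SPAM parameter; index j + 1 is the length 2^j. *)
- have := typical_means (ord0 : 'I_J.+2) t0 gG Nt N't.
  by rewrite /round_mean /= !expr0 !mulr1.
move=> j jJ; have jJ2 : (j.+1 < J.+2)%N by [].
exact: (typical_means (Ordinal jJ2) t0 gG Nt N't).
Qed.

End RoundStatistics.

(** * Assembly of the rounds and the estimator *)

Theorem proposition9 (R : realType) :
  exists C Ck Cm eps0 delta0 : R,
    [/\ 0 < C, 0 < Ck, 0 < Cm, 0 < eps0 & 0 < delta0] /\
    forall (n : nat) (G S : {group pauli n}),
      maximal_stabilizer_subgroup S G ->
    forall eps delta Delta : R,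
      0 < eps < eps0 -> 0 < delta < delta0 -> 0 < Delta <= 1 ->
    exists (r : nat) (H : 'I_r -> {group pauli n}) (m : 'I_r -> nat),
      let kappa := undup (codom m) in
      let t := shots eps delta (size kappa) #|G| in
      [/\ forall i, stabilizer_group (H i),
          r%:R = (size kappa)%:R * (Num.sqrt #|(G / S)%g|%:R + 1) :> R,
          (size kappa)%:R <= Ck * ln (1 / Delta),
          forall i, (m i)%:R <= Cm / Delta &
          exists est : data t H -> syndrome G -> R,
            forall N : noise R n,
              gtm N -> half_weak N -> half_stable N ->
              Delta <= spectral_gap N G ->
              1 - delta <=
                prob N m [pred D | l2norm (fun a => est D a - marginal_rate N a)
                                     <= C * eps * infidelity_norm N G]].
Proof.
have ln2_gt0 : 0 < ln 2 :> R by rewrite ln_gt0// ltr1n.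
(* The first and fourth constants come from [decay_rate_stable], the second and third from
   [exists_doubling_length]. *)
exists 2048, (4 / ln 2), 2, 128^-1, 1; split.
  by split; rewrite ?divr_gt0 ?invr_gt0 ?ltr0n.
move=> n G S maxS eps delta Delta /andP[eps_gt0 eps_lt] delta01 /andP[D_gt0 D_le1].
have [delta_gt0 delta_lt1] := andP delta01.
have [D_le|D_gt] := leP Delta 2^-1; last first.
  (* The gap of half-weak noise exceeds 1/2 only if G is trivial. *)
  exists 0%N, (fun=> 1%G : {group pauli n}), (fun=> 0%N).
  (* With no rounds [kappa] is empty, and the counts reduce to 0 = 0 and 0 <= ln (1 / Delta). *)
  have kappa0 : size (undup (codom (fun _ : 'I_0 => 0%N))) = 0%N.
    by apply/eqP; rewrite -leqn0 (leq_trans (size_undup _))// size_codom card_ord.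
  move=> kappa t; split=> [[]//|||[]//|].
  - by rewrite kappa0 mul0r.
  - by rewrite kappa0 mulr_ge0 ?divr_ge0 ?(ltW ln2_gt0) ?ln_ge0// div1r invf_ge1.
  pose close (v : syndrome G -> R) (N : noise R n) :=
    l2norm (fun a => v a - marginal_rate N a) <= 2048 * eps * infidelity_norm N G.
  pose compatible (N : noise R n) (D : data t (fun _ : 'I_0 => 1%G : {group pauli n})) :=
    [/\ gtm N, half_weak N & Delta <= spectral_gap N G].
  have [|est estP] := @exists_consistent_estimator _ _ _ compatible
      (fun N => @marginal_rate R n N G) close (fun=> 0).
    move=> N N' _ [Ngtm Nw Ngap] [N'gtm _ _].
    apply: marginal_rate_error => [|g gG]; first by rewrite mulr_ge0// ltW.
    have [->|g0] := eqVneq g 0.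
      rewrite !pauli_eigenvalue0// subrr normr0 mulr_ge0 ?mulr_ge0 ?(ltW eps_gt0)//.
      by apply: le_trans (infidelity_le_norm N (pauli_group0 G)).
    (* A nonzero [g] would have an eigenvalue at most 1 - Delta < 1/2, against [half_weak]. *)
    have := pauli_eigenvalue_le_gap gG g0 Ngap.
    by have /andP[f_ge _] := Nw g; lra.
  exists est => N Ngtm Nw _ Ngap.
  apply: le_trans (@prob_le _ _ N _ _ _ _ predT _ _ _ _) => //.
  - rewrite [prob _ _ _]sum_data_prob//; first lra.
    by case.
  - by case.
  by move=> D _; apply: estP.
have [J [DJ J_le k_le]] :=
  @exists_doubling_length R Delta (introT andP (conj D_gt0 D_le)).
have [k [H [Hst Hcover cardG]]] := isotropic_cover G.
exists (J.+2 * (2 ^ k).+1)%N, (fun i => H (round_group i)), (@round_length J (2 ^ k)).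
rewrite /= size_round_lengths; set t := shots _ _ _ _.
have [t_gt0 tail] := @shots_tail R eps delta J.+2 #|G| eps_gt0 delta01 isT (cardG_gt0 G).
split=> //.
- by rewrite (card_quotient_stabilizer R maxS cardG) natrM -[(2 ^ k).+1%:R]natr1 natrX.
- by move=> i; apply: le_trans J_le; rewrite ler_nat round_length_le.
pose close (v : syndrome G -> R) (N : noise R n) :=
  l2norm (fun a => v a - marginal_rate N a) <= 2048 * eps * infidelity_norm N G.
(* Admissible noises for which the data are typical; any two of them agree up to the claimed error,
   and the true one is among them with probability at least 1 - delta. *)
pose compatible (N : noise R n) (D : data t (fun i => H (@round_group J (2 ^ k) i))) :=
  [/\ gtm N, half_weak N, half_stable N & Delta <= spectral_gap N G]
  /\ typical G eps N D.
have [|est estP] := @exists_consistent_estimator _ _ _ compatible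
    (fun N => @marginal_rate R n N G) close (fun=> 0).
  move=> N N' D [[Ngtm Nw Ns Ngap] Nt] [[N'gtm N'w N's N'gap] N't].
  apply: marginal_rate_error => [|g gG]; first by rewrite mulr_ge0// ltW.
  apply: (typical_eigenvalues Hst Hcover t_gt0 _ DJ) gG Nt N't => //.
  by rewrite eps_gt0 ltW.
exists est => N Ngtm Nw Ns Ngap.
apply: (@le_trans _ _ (prob N (@round_length J (2 ^ k)) (@typical R n G J _ H t eps N))).
  apply: (prob_typical Hst Hcover) => //.
  by apply/andP; split; [exact: ltW | lra].
apply: prob_le => // D Dt; exact: estP.
Qed.
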